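(* Let $\mathbb{Z}^2$ act on $\mathbb{R}^2$ by lattice translations. A $\mathbb{Z}^2$-gain graph is $(2,2)$-tight if and only if it can be formed from $K_1$ (one vertex, no edges) by a sequence of gained $0$-extensions, $1$-extensions, edge-to-$K_3$ moves and vertex-to-$K_4$ moves.
   Context: A $\mathbb{Z}^2$-gain graph $(G,m)$ is a finite multigraph $G=(V,E)$ (loops, parallel edges allowed), edges oriented with gains in $\mathbb{Z}^2$ (written additively, so $g_1^{-1}g_2=g_2-g_1$), parallel edges of equal orientation having distinct gains and loops non-zero gains; $(v_i,v_j;g)$ is an edge from $v_i$ to $v_j$ with gain $g$ (same as $(v_j,v_i;-g)$). A multigraph is $(2,2)$-tight if $|E|=2|V|-2$ and every subgraph with $|E'|\ge1$ has $|E'|\le2|V'|-2$. Moves (result must again be a gain graph): gained 0-extension: add new vertex $v_0$ and edges $(v_0,v_1;g_1),(v_0,v_2;g_2)$, $v_1,v_2\in V$ not necessarily distinct. Gained 1-extension: remove an edge $(v_1,v_2;g)$ and add new $v_0$ with edges $(v_0,v_1;g_1),(v_0,v_2;g_2),(v_0,v_3;g_3)$, $v_3\in V$, with $g_2-g_1=g$ ($v_1,v_2,v_3$ not necessarily distinct). Gained edge-to-$K_3$ move: choose an edge $(v_1,v_2;g)$, keep it, add new $v_0$ with edges $(v_0,v_1;g_1),(v_0,v_2;g_2)$, $g_2-g_1=g$; every other edge $(v_1,w;h)$ is left unchanged or replaced by $(v_0,w;h)$. Gained vertex-to-$K_4$ move: replace a vertex $v_1$ by a copy of $K_4$ on $v_1$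 and three new vertices with all gains zero; every other edge $(v_1,w;h)$ ($w$ possibly $v_1$) is left unchanged or replaced by $(v_0,w;h)$ for another vertex $v_0$ of the copy. *)

(* Defs.v *)
From mathcomp Require Import all_boot all_order all_algebra.
Set Implicit Arguments.
Unset Strict Implicit.
Unset Printing Implicit Defensive.
Import GRing.Theory.
Local Open Scope ring_scope.

(* The gain group, written additively. *)
Notation Z2 := (int * int)%type.

(* (u, v, g) reads "an edge from u to v with gain g"; it denotes the same edge
   as (v, u, - g). *)
Definition gain_label (V : Type) := (V * V * Z2)%type.

Definition same_label (V : Type) (l l' : gain_label V) : Prop :=
  l = l' \/ l = (l'.1.2, l'.1.1, - l'.2).

Definition map_label (V V' : Type) (f : V -> V') (l : gain_label V) :
  gain_label V' := (f l.1.1, f l.1.2, l.2).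

Record gain_multigraph := GainMultigraph {
  vertex : finType;
  edge : finType;
  label : edge -> gain_label vertex }.

(* e is the edge (u, v; g), regardless of the orientation chosen for e in G. *)
Definition is_edge (G : gain_multigraph) (e : edge G) (u v : vertex G)
  (g : Z2) : Prop := same_label (label e) (u, v, g).

(* Parallel edges, once oriented the same way, have distinct gains, and loops
   have non-zero gains. *)
Definition is_gain_graph (G : gain_multigraph) : Prop :=
  (forall (e f : edge G) (u v : vertex G) (g : Z2),
     is_edge e u v g -> is_edge f u v g -> e = f) /\
  (forall (e : edge G) (v : vertex G), ~ is_edge e v v 0).

Definition is_subgraph (G : gain_multigraph)
  (A : {set vertex G}) (F : {set edge G}) : Prop :=
  forall e, e \in F -> (label e).1.1 \in A /\ (label e).1.2 \in A.

(* |E| = 2|V| - 2 and |E'| <= 2|V'| - 2 are integer relations: written without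
   the truncated subtraction of nat, so that the empty graph is not tight. *)
Definition tight22 (G : gain_multigraph) : Prop :=
  (#|edge G| + 2 = 2 * #|vertex G|)%N /\
  (forall (A : {set vertex G}) (F : {set edge G}), is_subgraph A F ->
     (1 <= #|F|)%N -> (#|F| + 2 <= 2 * #|A|)%N).

(* Names of vertices and edges, and the choice of orientations, are immaterial. *)
Definition gain_iso (G H : gain_multigraph) : Prop :=
  exists (phi : vertex G -> vertex H) (psi : edge G -> edge H),
    [/\ bijective phi, bijective psi &
        forall e, same_label (label (psi e)) (map_label phi (label e))].

(* The multigraph with edges labelled by l, and one more edge for each entry
   of s. *)
Definition add_edges (V E : finType) (l : E -> gain_label V)
  (s : seq (gain_label V)) : gain_multigraph :=
  @GainMultigraph V (E + 'I_(size s))%type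
    (fun e => match e with inl e => l e | inr i => tnth (in_tuple s) i end).

(* In the three moves below that add one vertex v0, the new vertex set is
   [option (vertex G)] and v0 is [None]. *)
Definition zero_extension (G H : gain_multigraph) : Prop :=
  exists (v1 v2 : vertex G) (g1 g2 : Z2),
    gain_iso H
      (add_edges (fun e : edge G => map_label Some (label e))
         [:: (None, Some v1, g1); (None, Some v2, g2)]).

Definition one_extension (G H : gain_multigraph) : Prop :=
  exists (e : edge G) (v1 v2 v3 : vertex G) (g g1 g2 g3 : Z2),
    [/\ is_edge e v1 v2 g, g2 - g1 = g &
        gain_iso H
          (add_edges (fun f : {f : edge G | f != e} =>
                        map_label Some (label (val f)))
             [:: (None, Some v1, g1); (None, Some v2, g2);
                 (None, Some v3, g3)])].

(* The edge l, seen through the inclusion i of the old vertices, is left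
   unchanged as l', or l is some (v1, w; h) and l' is (v0, w; h) for some v0
   in N. If l is a loop at v1, exactly one of its two ends is redirected. *)
Definition kept_or_moved (V V' : Type) (i : V -> V') (v1 : V)
  (N : V' -> Prop) (l : gain_label V) (l' : gain_label V') : Prop :=
  same_label l' (map_label i l) \/
  exists (w : V) (h : Z2) (v0 : V'),
    [/\ same_label l (v1, w, h), N v0 & same_label l' (v0, i w, h)].

Definition edge_to_K3 (G H : gain_multigraph) : Prop :=
  exists (e : edge G) (v1 v2 : vertex G) (g g1 g2 : Z2)
         (l : edge G -> gain_label (option (vertex G))),
    [/\ is_edge e v1 v2 g, g2 - g1 = g,
        l e = map_label Some (label e),
        (forall f, f != e ->
           kept_or_moved Some v1 (fun v0 => v0 = None) (label f) (l f)) &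
        gain_iso H
          (add_edges l [:: (None, Some v1, g1); (None, Some v2, g2)])].

(* The copy of K4 is on inl v1 and the three vertices inr j, j : 'I_3. *)
Definition vertex_to_K4 (G H : gain_multigraph) : Prop :=
  exists (v1 : vertex G) (l : edge G -> gain_label (vertex G + 'I_3)),
    (forall f, kept_or_moved inl v1 (fun v0 => exists j, v0 = inr j)
                 (label f) (l f)) /\
    gain_iso H
      (add_edges l
         [:: (inl v1, inr 0, 0); (inl v1, inr 1, 0); (inl v1, inr 2, 0);
             (inr 0, inr 1, 0); (inr 0, inr 2, 0); (inr 1, inr 2, 0)]).

Inductive constructible : gain_multigraph -> Prop :=
| constructible_K1 (G : gain_multigraph) :
    #|vertex G| = 1%N -> #|edge G| = 0%N -> constructible G
| constructible_move (G H : gain_multigraph) :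
    constructible G ->
    [\/ zero_extension G H, one_extension G H, edge_to_K3 G H |
        vertex_to_K4 G H] ->
    is_gain_graph H ->
    constructible H.

(* Main.v *)
Require Import Defs.
From mathcomp Require Import all_boot all_order all_algebra.
From mathcomp Require Import zify.
Set Implicit Arguments.
Unset Strict Implicit.
Unset Printing Implicit Defensive.
Import GRing.Theory.
Local Open Scope ring_scope.

(* Each move preserves tightness because a vertex set A of the new graph is
   compared with its image in the old graph under the map that merges the new
   vertices into the vertex they come from.

   Conversely a tight graph with at least two vertices can always be reduced.
   The gains cannot be normalised, as the moves do not allow switching, but this
   only helps. A vertex v of degree 2 can be removed, and if a vertex v of degree
   3 admits no inverse 1-extension, then v and its neighbours span a balanced K4.
   If some edge of this K4 at v has a non-zero gain, then contracting it creates
   no duplicate edge and is an inverse edge-to-K3 move. Otherwise all gains of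
   the K4 are zero, and contracting the K4 fails only if some vertex w outside is
   joined by equal gains to two vertices x and y of it. If the contractions of
   wx and wy fail as well, then x and y have degree at least 5. If this happens
   for all vertices of degree 3, a discharging argument contradicts
   the fact that the degrees sum to 4|V| - 4. *)

Lemma same_label_sym (V : Type) (l l' : gain_label V) :
  same_label l l' -> same_label l' l.
Proof.
move: l l' => [[u v] g] [[u' v'] g'] [->|->]; first by left.
by right; rewrite /= opprK.
Qed.

Lemma same_label_trans (V : Type) (l2 l1 l3 : gain_label V) :
  same_label l1 l2 -> same_label l2 l3 -> same_label l1 l3.
Proof.
move: l3 => [[u v] g] [->|->] // [->|->]; rewrite /same_label /= ?opprK; auto.
Qed.

Lemma same_label_map (V V' : Type) (f : V -> V') (l l' : gain_label V) :
  same_label l l' -> same_label (map_label f l) (map_label f l').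
Proof. by case=> ->; [left | right]. Qed.

Lemma kept_or_movedK (V V' : Type) (i : V -> V') (c : V' -> V) (v1 : V)
    (N : V' -> Prop) (l : gain_label V) (l' : gain_label V') :
  (forall v, c (i v) = v) -> (forall v0, N v0 -> c v0 = v1) ->
  kept_or_moved i v1 N l l' -> same_label (map_label c l') l.
Proof.
move=> iK cN [/(same_label_map c)|[w [h [v0 [ll Nv0 /(same_label_map c) ll']]]]].
  by rewrite /map_label /= !iK; case: l => [[]].
apply: same_label_trans ll' _; apply: same_label_sym.
by rewrite /map_label /= iK cN.
Qed.

Definition inside (V : finType) (A : {set V}) (l : gain_label V) : bool :=
  (l.1.1 \in A) && (l.1.2 \in A).

Lemma inside_same (V : finType) (A : {set V}) (l l' : gain_label V) :
  same_label l l' -> inside A l = inside A l'.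
Proof. by rewrite /inside; case=> -> //=; rewrite andbC. Qed.

Lemma inside_map (V V' : finType) (f : V -> V') (A : {set V}) (l : gain_label V) :
  inside A l -> inside (f @: A) (map_label f l).
Proof. by case/andP=> ? ?; rewrite /inside /= !imset_f. Qed.

Lemma inside_preim (V V' : finType) (f : V -> V') (A : {set V'})
    (l : gain_label V) :
  inside A (map_label f l) = inside (f @^-1: A) l.
Proof. by rewrite /inside /= !inE. Qed.

Definition induced (V E : finType) (l : E -> gain_label V) (A : {set V}) :
  {set E} := [set e | inside A (l e)].

(** * Tightness is preserved by the moves *)

Definition sparse (G : gain_multigraph) : Prop :=
  forall A : {set vertex G}, A != set0 ->
    (#|induced (@label G) A| + 2 <= 2 * #|A|)%N.

Lemma tight22E (G : gain_multigraph) :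
  tight22 G <-> (#|edge G| + 2 = 2 * #|vertex G|)%N /\ sparse G.
Proof.
split=> [[cE subE]|[cE spG]]; split=> //.
  move=> A A0; case: (posnP #|induced (@label G) A|) => [->|i_gt0].
    by have := A0; rewrite -card_gt0; lia.
  by apply: subE => // e; rewrite inE => /andP[].
move=> A F FA F1; have sFA: F \subset induced (@label G) A.
  by apply/subsetP=> e /FA[eA eA']; rewrite inE /inside eA.
have A0: A != set0.
  have /card_gt0P[e /FA[eA _]] := F1.
  by apply/set0Pn; exists (label e).1.1.
by have := spG A A0; have := subset_leq_card sFA; lia.
Qed.

Lemma card_induced_add (V E : finType) (l : E -> gain_label V)
    (s : seq (gain_label V)) (A : {set V}) :
  #|induced (@label (add_edges l s)) A| = (#|induced l A| + count (inside A) s)%N.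
Proof.
rewrite -sum1dep_card big_sumType /= sum1dep_card; congr (_ + _)%N.
by rewrite -[in RHS](in_tupleE s) -sum1_count big_tuple.
Qed.

Lemma card_edge_add (V E : finType) (l : E -> gain_label V)
    (s : seq (gain_label V)) :
  #|edge (add_edges l s)| = (#|E| + size s)%N.
Proof. by rewrite /= card_sum card_ord. Qed.

Lemma gain_iso_tight (G H : gain_multigraph) :
  gain_iso H G -> tight22 G -> tight22 H.
Proof.
case=> phi [psi [bphi bpsi lab]] /tight22E[cE spG]; apply/tight22E.
rewrite (bij_eq_card bphi) (bij_eq_card bpsi); split=> // A A0.
rewrite -(card_imset (mem A) (bij_inj bphi)).
have /spG : phi @: A != set0 by rewrite imset_eq0.
apply: leq_trans; rewrite leq_add2r.
rewrite -(card_imset (mem (induced (@label H) A)) (bij_inj bpsi)).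
apply/subset_leq_card/subsetP=> _ /imsetP[e eA ->]; move: eA; rewrite !inE.
by rewrite (inside_same _ (lab e)); apply: inside_map.
Qed.

Lemma sparse_no_loop (G : gain_multigraph) (e : edge G) (u v : vertex G) g :
  sparse G -> is_edge e u v g -> u != v.
Proof.
move=> spG euv; apply/eqP=> uv; subst v.
have := spG [set u]; rewrite cards1.
have -> : [set u] != set0 by apply/set0Pn; exists u; rewrite inE.
have : (0 < #|induced (@label G) [set u]|)%N; last by lia.
by apply/card_gt0P; exists e; rewrite inE (inside_same _ euv) /inside /= inE eqxx.
Qed.

Lemma card_preim_Some (V : finType) (A : {set option V}) :
  #|A| = (#|Some @^-1: A| + (None \in A))%N.
Proof.
rewrite -(card_imset (mem (Some @^-1: A)) (@Some_inj _)) addnC (cardsD1 None A).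
congr (_ + _)%N; apply: eq_card=> -[x|]; rewrite !inE.
  apply/idP/imsetP=> [xA|[y yA [->]]]; last by move: yA; rewrite inE.
  by exists x; rewrite ?inE.
by apply/esym/imsetP; case.
Qed.

Lemma induced0 (V E : finType) (l : E -> gain_label V) : induced l set0 = set0.
Proof. by apply/setP=> e; rewrite !inE /inside inE. Qed.

Lemma subset_induced (V E : finType) (l : E -> gain_label V) (A B : {set V}) :
  A \subset B -> induced l A \subset induced l B.
Proof.
move=> /subsetP sAB; apply/subsetP=> e; rewrite !inE /inside.
by case/andP=> /sAB-> /sAB->.
Qed.

Lemma zero_extension_tight (G H : gain_multigraph) :
  zero_extension G H -> tight22 G -> tight22 H.
Proof.
case=> v1 [v2 [g1 [g2 isoH]]] /tight22E[cE spG].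
apply: gain_iso_tight isoH _; apply/tight22E; split.
  by rewrite card_edge_add card_option /= mulnS -cE addnC.
move=> A A0; rewrite card_induced_add card_preim_Some.
set B := Some @^-1: A.
have memB v : (Some v \in A) = (v \in B) by rewrite inE.
have -> : induced (fun e : edge G => map_label Some (label e)) A
        = induced (@label G) B.
  by apply/setP=> e; rewrite !inE inside_preim.
rewrite /= /inside /= !memB.
case: (eqVneq B set0) => [B0|/spG]; last first.
  by case: (None \in A); case: (v1 \in B); case: (v2 \in B) => /=; lia.
have : (0 < #|A|)%N by rewrite card_gt0.
by rewrite card_preim_Some -/B B0 induced0 !cards0 !inE; case: (None \in A).
Qed.

Lemma one_extension_tight (G H : gain_multigraph) :
  one_extension G H -> tight22 G -> tight22 H.
Proof.
case=> e [v1 [v2 [v3 [g [g1 [g2 [g3 [ev _ isoH]]]]]]]] /tight22E[cE spG].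
apply: gain_iso_tight isoH _; apply/tight22E; split.
  have E1 : #|edge G| = #|{: {f : edge G | f != e}}|.+1.
    by rewrite card_sig (cardD1 e) inE add1n; congr S; apply: eq_card => f;
      rewrite !inE andbT.
  by rewrite card_edge_add card_option /= mulnS -cE E1 [RHS]addnC -!addnA [RHS]addSnnS.
move=> A A0; rewrite card_induced_add card_preim_Some.
set B := Some @^-1: A.
have memB v : (Some v \in A) = (v \in B) by rewrite inE.
have -> : #|induced (fun f : {f : edge G | f != e} =>
                       map_label Some (label (val f))) A|
        = #|induced (@label G) B :\ e|.
  rewrite -(card_imset _ val_inj); apply: eq_card=> f.
  apply/imsetP/idP=> [[x xA ->]|fB].
    by rewrite in_setD1 inE -inside_preim; move: xA; rewrite inE => ->; rewrite (valP x).
  move: fB; rewrite in_setD1 inE => /andP[fe fB].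
  by exists (Sub f fe); rewrite ?SubK // inE SubK inside_preim.
rewrite /= /inside /= !memB.
case: (eqVneq B set0) => [B0|/spG]; last first.
  rewrite (cardsD1 e (induced _ B)) inE (inside_same _ ev) /inside /=.
  by case: (None \in A); case: (v1 \in B); case: (v2 \in B); case: (v3 \in B) => /=; lia.
have : (0 < #|A|)%N by rewrite card_gt0.
by rewrite card_preim_Some -/B B0 induced0 set0D !cards0 !inE; case: (None \in A).
Qed.

Lemma edge_to_K3_tight (G H : gain_multigraph) :
  edge_to_K3 G H -> tight22 G -> tight22 H.
Proof.
case=> e [v1 [v2 [g [g1 [g2 [l [ev _ le lf isoH]]]]]]] /tight22E[cE spG].
apply: gain_iso_tight isoH _; apply/tight22E; split.
  by rewrite card_edge_add card_option /= mulnS -cE addnC.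
move=> A A0; rewrite card_induced_add card_preim_Some.
set B := Some @^-1: A.
have memB v : (Some v \in A) = (v \in B) by rewrite inE.
pose c := odflt v1; set C := c @: A.
have lK f : same_label (map_label c (l f)) (label f).
  case: (eqVneq f e) => [->|/lf]; last first.
    by apply: kept_or_movedK => // v0 ->.
  by rewrite le; left; case: (label e) => [[]].
have sBC f : f \in induced l A -> f \in induced (@label G) C.
  by rewrite !inE -(inside_same _ (lK f)); apply: inside_map.
have C0 : C != set0 by rewrite imset_eq0.
have CE : C = (if None \in A then v1 |: B else B).
  apply/setP=> x; apply/imsetP/idP=> [[[y|] yA ->]|].
  - by case: ifP => _; rewrite !inE yA ?orbT.
  - by rewrite yA !inE eqxx.
  case: ifP => NA; rewrite !inE; last by exists (Some x).
  by case/orP=> [/eqP->|xA]; [exists None | exists (Some x)].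
have sub: induced l A \subset induced (@label G) C by apply/subsetP.
have := spG C C0; have := subset_leq_card sub.
rewrite /= /inside /= !memB CE.
case NA : (None \in A); rewrite ?cardsU1 /=; last by lia.
case v1B : (v1 \in B) => /=; first by lia.
case v2B : (v2 \in B) => /=; last by lia.
have eC : e \in induced (@label G) C.
  by rewrite inE (inside_same _ ev) /inside CE NA /= in_setU1 eqxx in_setU1 v2B orbT.
have : induced l A \subset induced (@label G) C :\ e.
  apply/subsetP=> f fA; rewrite in_setD1 sBC // andbT; apply/eqP=> fe.
  move: fA; rewrite fe inE le inside_preim (inside_same _ ev) /inside /=.
  by rewrite -/B v1B.
move/subset_leq_card; have := cardsD1 e (induced (@label G) C); rewrite eC CE NA.
lia.
Qed.

Lemma vertex_to_K4_tight (G H : gain_multigraph) :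
  vertex_to_K4 G H -> tight22 G -> tight22 H.
Proof.
case=> v1 [l [lf isoH]] /tight22E[cE spG].
apply: gain_iso_tight isoH _; apply/tight22E; split.
  by rewrite card_edge_add card_sum card_ord /= mulnDr -cE -!addnA.
move=> A A0; rewrite card_induced_add.
pose c (x : vertex G + 'I_3) := if x is inl v then v else v1; set C := c @: A.
have lK f : same_label (map_label c (l f)) (label f).
  by move: (lf f); apply: kept_or_movedK => // v0 [j ->].
have /subset_leq_card : induced l A \subset induced (@label G) C.
  apply/subsetP=> f.
  by rewrite !inE -(inside_same _ (lK f)); apply: inside_map.
have C0 : C != set0 by rewrite imset_eq0.
have := spG C C0.
pose B := inl @^-1: A; pose D := @inr (vertex G) 'I_3 @^-1: A.
have -> : #|A| = (#|B| + #|D|)%N.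
  have inlI : injective (@inl (vertex G) 'I_3) by move=> x y [].
  have inrI : injective (@inr (vertex G) 'I_3) by move=> x y [].
  rewrite -(card_imset (mem B) inlI) -(card_imset (mem D) inrI) -cardsUI.
  rewrite [X in (_ + #|pred_of_set X|)%N](_ : _ = set0) ?cards0 ?addn0; last first.
    by apply/setP=> x; rewrite !inE; apply/andP=> -[/imsetP[y _ ->] /imsetP[]].
  apply: eq_card=> -[x|x]; rewrite !inE.
    rewrite mem_imset ?inE //; case: imsetP => [[]|] //; by rewrite orbF.
  rewrite orbC mem_imset ?inE //; case: imsetP => [[]|] //; by rewrite orbF.
have cD : #|D| = ((0%R \in D) + (1%R \in D) + (2%:R \in D))%N.
  rewrite -sum1_card big_mkcond !big_ord_recl big_ord0 /= addn0.
  rewrite addnA; do 3?[congr addn]; congr (nat_of_bool (_ \in D)); exact: val_inj.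
have memB v : (inl v \in A) = (v \in B) by rewrite inE.
have memD j : (inr j \in A) = (j \in D) by rewrite inE.
have CE : C = (if D == set0 then B else v1 |: B).
  apply/setP=> x; apply/imsetP/idP=> [[[y|j] yA ->]|].
  - by rewrite memB in yA; case: ifP => _; rewrite /= ?in_setU1 yA ?orbT.
  - rewrite memD in yA; case: ifP => [/eqP D0|_]; last by rewrite in_setU1 eqxx.
    by rewrite D0 inE in yA.
  case: ifPn => [_ xB|/set0Pn[j jD]]; first by exists (inl x); rewrite ?memB.
  case/setU1P=> [->|xB]; last by exists (inl x); rewrite ?memB.
  by exists (inr j); rewrite ?memD.
rewrite /= /inside /= !memB !memD CE -cards_eq0 cD.
by case: (0%R \in D); case: (1%R \in D); case: (2%:R \in D);
  case: (v1 \in B) (cardsU1 v1 B) => /=; lia.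
Qed.

Lemma card_sig_neq (T : finType) (x : T) : (#|{: {y | y != x}}| + 1 = #|T|)%N.
Proof.
by rewrite card_sig (cardD1 x T) inE addnC; congr (_ + _)%N; apply: eq_card => y;
  rewrite !inE andbT.
Qed.

(** * Tight vertex sets *)

Definition edgeb (G : gain_multigraph) (e : edge G) (u v : vertex G) (g : Z2) :
  bool := (label e == (u, v, g)) || (label e == (v, u, - g)).

Lemma edgebP (G : gain_multigraph) (e : edge G) u v g :
  reflect (is_edge e u v g) (edgeb e u v g).
Proof. by apply: (iffP orP) => -[/eqP|/eqP]; [left|right|left|right]. Qed.

Lemma is_edge_rev (G : gain_multigraph) (e : edge G) u v g :
  is_edge e u v g -> is_edge e v u (- g).
Proof. by rewrite /is_edge /same_label /= opprK => -[]; auto. Qed.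

Lemma is_edge_end (G : gain_multigraph) (e : edge G) u v w g h :
  is_edge e u v g -> is_edge e u w h -> v = w.
Proof. by rewrite /is_edge => -[->|->] [] [] *; congruence. Qed.

Lemma is_edge_gain (G : gain_multigraph) (e : edge G) u v g h :
  u != v -> is_edge e u v g -> is_edge e u v h -> g = h.
Proof.
move=> /eqP uv; rewrite /is_edge => -[->|->] [] E;
  have /= u_eq := congr1 (fun l => l.1.1) E; have /= g_eq := congr1 snd E.
- exact: g_eq.
- by case: uv.
- by case: uv.
exact: oppr_inj.
Qed.

Definition joined (G : gain_multigraph) (u v : vertex G) : bool :=
  [exists e : edge G, edgeb e u v (label e).2 || edgeb e u v (- (label e).2)].

Lemma joinedP (G : gain_multigraph) (u v : vertex G) :
  reflect (exists e g, is_edge e u v g) (joined u v).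
Proof.
apply: (iffP existsP) => [[e /orP[]/edgebP eE]|[e [g eE]]]; exists e.
- by exists (label e).2.
- by exists (- (label e).2).
by move: eE; rewrite /is_edge => -[] E; rewrite /edgeb E /= ?opprK eqxx ?orbT.
Qed.

Lemma inside_edge (G : gain_multigraph) (A : {set vertex G}) (e : edge G) u v g :
  is_edge e u v g -> (e \in induced (@label G) A) = (u \in A) && (v \in A).
Proof. by move=> eE; rewrite inE (inside_same _ eE). Qed.

Definition incident (G : gain_multigraph) (x : vertex G) : {set edge G} :=
  [set e | ((label e).1.1 == x) || ((label e).1.2 == x)].

Definition degree (G : gain_multigraph) (x : vertex G) : nat := #|incident x|.

Lemma incidentP (G : gain_multigraph) (x : vertex G) (e : edge G) :
  reflect (exists w g, is_edge e x w g) (e \in incident x).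
Proof.
rewrite inE /is_edge; apply: (iffP idP) => [|[w [g [->|->]]]]; rewrite /= ?eqxx ?orbT //.
case: (label e) => [[u v] g] /orP[]/eqP /= ->.
  by exists v, g; left.
by exists u, (- g); right; rewrite opprK.
Qed.

Lemma joined_edges (G : gain_multigraph) (x : vertex G) (S : {set vertex G}) :
  (forall s, s \in S -> joined x s) ->
  exists2 F : {set edge G}, #|F| = #|S| &
    forall f, f \in F -> exists w g, w \in S /\ is_edge f x w g.
Proof.
move=> xS.
have [S0|[s0 s0S]] := set_0Vmem S.
  by exists set0 => [|f]; rewrite ?S0 ?cards0 ?inE.
have [e0 _] := joinedP _ _ (xS _ s0S).
pose pick_e s := odflt e0 [pick e | (e \in incident x) && (e \in incident s) &
  edgeb e x s (label e).2 || edgeb e x s (- (label e).2)].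
have pickP s : s \in S -> exists g, is_edge (pick_e s) x s g.
  move=> /xS/joinedP[e [g eE]]; rewrite /pick_e; case: pickP => [f|/(_ e)] /=.
    by case/andP=> _ /orP[]/edgebP fE; [exists (label f).2|exists (- (label f).2)].
  have -> : e \in incident x by apply/incidentP; exists s, g.
  have -> : e \in incident s by apply/incidentP; exists x, (- g); apply: is_edge_rev.
  by move: eE; rewrite /is_edge => -[] E; rewrite /edgeb E /= ?opprK eqxx ?orbT.
exists (pick_e @: S).
  apply: card_in_imset => s t /pickP[g sE] /pickP[h tE] E; rewrite E in sE.
  exact: is_edge_end sE tE.
by move=> _ /imsetP[s sS ->]; have [g sE] := pickP s sS; exists s, g.
Qed.

Lemma degree_ge (G : gain_multigraph) (x : vertex G) (S : {set vertex G}) :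
  (forall s, s \in S -> joined x s) -> (#|S| <= degree x)%N.
Proof.
move=> /joined_edges[F <- FE]; apply/subset_leq_card/subsetP=> f /FE[w [g [_ fE]]].
by apply/incidentP; exists w, g.
Qed.

Lemma induced_setU1_edges (G : gain_multigraph) (A : {set vertex G})
    (x : vertex G) (F : {set edge G}) :
  x \notin A ->
  (forall f, f \in F -> exists w g, w \in A /\ is_edge f x w g) ->
  (#|induced (@label G) A| + #|F| <= #|induced (@label G) (x |: A)|)%N.
Proof.
move=> xA FE; rewrite -cardsUI [X in (_ + X)%N](_ : _ = 0%N) ?addn0; last first.
  apply/eqP; rewrite cards_eq0 setI_eq0; apply/pred0P=> f /=.
  apply/andP=> -[fA /FE[w [g [wA fE]]]].
  by rewrite (inside_edge _ fE) (negPf xA) in fA.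
apply/subset_leq_card; rewrite subUset subset_induced ?subsetUr //=.
apply/subsetP=> f /FE[w [g [wA fE]]].
by rewrite (inside_edge _ fE) !inE eqxx wA orbT.
Qed.

Lemma induced_setU1_joined (G : gain_multigraph) (A S : {set vertex G})
    (x : vertex G) :
  x \notin A -> S \subset A -> (forall s, s \in S -> joined x s) ->
  (#|induced (@label G) A| + #|S| <= #|induced (@label G) (x |: A)|)%N.
Proof.
move=> xA /subsetP sSA /joined_edges[F <- FE].
apply: induced_setU1_edges => // f /FE[w [g [/sSA wA fE]]]; by exists w, g.
Qed.

Definition tight_set (G : gain_multigraph) (A : {set vertex G}) : bool :=
  (A != set0) && (2 * #|A| <= #|induced (@label G) A| + 2)%N.

Lemma tight_setUI (G : gain_multigraph) (A B : {set vertex G}) (x : vertex G) :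
  sparse G -> tight_set A -> tight_set B -> x \in A -> x \in B ->
  tight_set (A :|: B).
Proof.
move=> spG /andP[A0 tA] /andP[B0 tB] xA xB; apply/andP; split.
  by apply/set0Pn; exists x; rewrite inE xA.
have AB0 : A :&: B != set0 by apply/set0Pn; exists x; rewrite inE xA.
have := spG _ AB0; have := cardsUI A B.
have := cardsUI (induced (@label G) A) (induced (@label G) B).
have <- : induced (@label G) (A :&: B)
        = induced (@label G) A :&: induced (@label G) B.
  by apply/setP=> e; rewrite !inE /inside !inE andbACA.
have /subset_leq_card : induced (@label G) A :|: induced (@label G) B
    \subset induced (@label G) (A :|: B).
  by rewrite subUset !subset_induced ?subsetUl ?subsetUr.
lia.
Qed.

Lemma tight_set_joined (G : gain_multigraph) (A S : {set vertex G})
    (x : vertex G) :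
  sparse G -> tight_set A -> x \notin A -> S \subset A ->
  (forall s, s \in S -> joined x s) ->
  (#|S| <= 2)%N /\ (#|S| = 2%N -> tight_set (x |: A))%N.
Proof.
move=> spG /andP[A0 tA] xA sSA xS.
have := induced_setU1_joined xA sSA xS.
have xA0 : x |: A != set0 by apply/set0Pn; exists x; rewrite !inE eqxx.
have := spG _ xA0; rewrite /tight_set xA0 cardsU1 xA; lia.
Qed.

Lemma tight_set_edges (G : gain_multigraph) (A : {set vertex G})
    (F : {set edge G}) (x : vertex G) :
  sparse G -> tight_set A -> x \notin A ->
  (forall f, f \in F -> exists w g, w \in A /\ is_edge f x w g) ->
  (#|F| <= 2)%N /\ (#|F| = 2%N -> tight_set (x |: A))%N.
Proof.
move=> spG /andP[A0 tA] xA FE.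
have := induced_setU1_edges xA FE.
have xA0 : x |: A != set0 by apply/set0Pn; exists x; rewrite !inE eqxx.
have := spG _ xA0; rewrite /tight_set xA0 cardsU1 xA; lia.
Qed.

Definition clique (G : gain_multigraph) (K : {set vertex G}) : bool :=
  [forall p in K, forall q in K, (p != q) ==> joined p q].

Lemma cliqueP (G : gain_multigraph) (K : {set vertex G}) :
  reflect (forall p q, p \in K -> q \in K -> p != q -> joined p q) (clique K).
Proof.
apply: (iffP forall_inP) => [cK p q pK qK|cK p pK].
  by have /forall_inP/(_ q qK)/implyP := cK p pK.
by apply/forall_inP=> q qK; apply/implyP; apply: cK.
Qed.

Lemma clique_induced (G : gain_multigraph) (K : {set vertex G}) :
  clique K -> ('C(#|K|, 2) <= #|induced (@label G) K|)%N.
Proof.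
move: {2}#|K| (erefl #|K|) => n; elim: n K => [|n IHn] K cardK /cliqueP cK.
  by rewrite cardK.
have /card_gt0P[x xK] : (0 < #|K|)%N by rewrite cardK.
have Kx : #|K :\ x| = n by have := cardsD1 x K; rewrite xK cardK; lia.
have cKx : clique (K :\ x).
  by apply/cliqueP=> p q; rewrite !inE => /andP[_ pK] /andP[_ qK]; apply: cK.
have := IHn _ Kx cKx; rewrite Kx cardK binS bin1.
have := @induced_setU1_joined G (K :\ x) (K :\ x) x.
rewrite setD11 subxx setD1K // Kx => /(_ isT isT) /=.
have xKx s : s \in K :\ x -> joined x s.
  by rewrite !inE => /andP[sx sK]; apply: cK; rewrite // eq_sym.
by move=> /(_ xKx); lia.
Qed.

Lemma clique4_tight (G : gain_multigraph) (K : {set vertex G}) :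
  clique K -> #|K| = 4%N -> tight_set K.
Proof.
move=> /clique_induced + K4; rewrite /tight_set -card_gt0 K4.
by rewrite (_ : 'C(4, 2) = 6)%N //=; lia.
Qed.

Lemma clique4_sub (G : gain_multigraph) (A K : {set vertex G}) (p q : vertex G) :
  sparse G -> clique K -> #|K| = 4%N -> tight_set A ->
  p \in A :&: K -> q \in A :&: K -> p != q -> K \subset A.
Proof.
move=> spG /cliqueP cK K4 tA pAK qAK pq; apply/subsetP=> x xK; apply/idPn=> xA.
have KS (B : {set vertex G}) y s : y \in K -> y \notin B -> s \in B :&: K -> joined y s.
  move=> yK yB /setIP[sB sK]; apply: cK => //.
  by apply: contraNneq yB => ->.
have AK2 : (2 <= #|A :&: K|)%N.
  rewrite (cardsD1 p) pAK (cardsD1 q) !inE eq_sym pq /=.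
  by move: qAK; rewrite inE => ->.
have [le2 t2] := tight_set_joined spG tA xA (subsetIl A K)
  (fun s => @KS A x s xK xA).
have {t2} txA : tight_set (x |: A) by apply: t2; lia.
have xAK : #|(x |: A) :&: K| = 3%N.
  rewrite setIUl (setIidPl _) ?sub1set // cardsU1 inE (negPf xA) /=; lia.
have /set0Pn[y] : K :\: (x |: A) != set0.
  have := cardsID (x |: A) K; rewrite setIC xAK K4 -card_gt0; lia.
rewrite inE => /andP[yxA yK].
have [] := tight_set_joined spG txA yxA (subsetIl _ K)
  (fun s => @KS _ y s yK yxA).
by rewrite xAK.
Qed.

Lemma degree_induced (G : gain_multigraph) (x : vertex G) :
  (#|induced (@label G) [set~ x]| + degree x = #|edge G|)%N.
Proof.
rewrite /degree -cardsUI [X in (_ + X)%N](_ : _ = 0%N) ?addn0; last first.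
  apply/eqP; rewrite cards_eq0 setI_eq0; apply/pred0P=> f /=.
  by rewrite !inE /inside !inE; do 2![case: eqP => _].
rewrite -cardsT; apply: eq_card => f; rewrite !inE /inside !inE.
by do 2![case: eqP => _].
Qed.

Lemma sum_degree (G : gain_multigraph) :
  sparse G -> (\sum_(x : vertex G) degree x = 2%N * #|edge G|)%N.
Proof.
move=> spG; rewrite /degree.
transitivity (\sum_(x : vertex G) \sum_(e : edge G) (e \in incident x : nat))%N.
  by apply: eq_bigr => x _; rewrite -sum1_card big_mkcond.
rewrite exchange_big /= mulnC -sum_nat_const; apply: eq_bigr => e _.
rewrite (eq_bigr (fun x => (x \in [set (label e).1.1; (label e).1.2]) : nat)); last first.
  by move=> x _; rewrite !inE !(eq_sym x).
rewrite -big_mkcond sum1_card cards2.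
suff -> : (label e).1.1 != (label e).1.2 by [].
apply: (@sparse_no_loop _ e _ _ (label e).2 spG).
by left; case: (label e) => [[]].
Qed.

(** * Inverse moves *)

Lemma same_label_mapK (V V' : Type) (r : V -> V') (l l' : gain_label V) :
  same_label (map_label r l) (map_label r l') ->
  exists x y x' y' g, [/\ same_label l (x, y, g), same_label l' (x', y', g),
    r x = r x' & r y = r y'].
Proof.
move: l l' => [[x y] g] [[x' y'] g'].
rewrite /map_label /same_label /= => -[] E;
  have /= rx := congr1 (fun l => l.1.1) E; have /= ry := congr1 (fun l => l.1.2) E;
  have /= gg := congr1 snd E.
  by exists x, y, x', y', g; rewrite gg; split; auto.
by exists x, y, y', x', g; rewrite gg opprK; split; auto.
Qed.

Definition same_labelb (V : eqType) (l l' : gain_label V) : bool :=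
  (l == l') || (l == (l'.1.2, l'.1.1, - l'.2)).

Lemma same_labelP (V : eqType) (l l' : gain_label V) :
  reflect (same_label l l') (same_labelb l l').
Proof. by apply: (iffP orP) => -[/eqP|/eqP]; [left|right|left|right]. Qed.

Lemma gain_graph_inj (G : gain_multigraph) (e f : edge G) :
  is_gain_graph G -> same_label (label e) (label f) -> e = f.
Proof.
move=> [uniqG _] ef; apply: (uniqG e f (label f).1.1 (label f).1.2 (label f).2).
  by rewrite /is_edge; case: (label f) ef => [[]].
by left; case: (label f) => [[]].
Qed.

Lemma gain_iso_add_edges (H : gain_multigraph) (V E : finType)
    (l : E -> gain_label V) (s : seq (gain_label V)) (theta : V -> vertex H) :
  is_gain_graph H -> injective theta -> #|vertex H| = #|V| ->
  (#|E| + size s = #|edge H|)%N ->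
  (forall e, (exists e', same_label (label e) (map_label theta (l e'))) \/
     exists2 l0, l0 \in s & same_label (label e) (map_label theta l0)) ->
  gain_iso H (add_edges l s).
Proof.
move=> gH thI cV cE lH.
have exE (e : edge H) : exists e' : edge (add_edges l s),
    same_labelb (label e) (map_label theta (label e')).
  case: (lH e) => [[e' /same_labelP ee']|[l0 /seq_tnthP[i ->] /same_labelP ei]].
    by exists (inl e').
  by exists (inr i).
pose psi e := xchoose (exE e).
have psiP e : same_label (label e) (map_label theta (label (psi e))).
  exact/same_labelP/(xchooseP (exE e)).
have psiI : injective psi.
  move=> e f ef; apply: gain_graph_inj => //; apply: same_label_trans (psiP e) _.
  by rewrite ef; apply: same_label_sym.
have [phi thK phiK] : bijective theta by apply: inj_card_bij => //; rewrite cV.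
exists phi, psi; split.
- by exists theta.
- by apply: inj_card_bij => //; rewrite card_edge_add cE.
move=> e; apply: same_label_sym.
apply: same_label_trans (same_label_map phi (psiP e)) _; left.
by case: (label (psi e)) => [[x y] g]; rewrite /map_label /= !thK.
Qed.

Definition gained_move (G H : gain_multigraph) : Prop :=
  [\/ zero_extension G H, one_extension G H, edge_to_K3 G H | vertex_to_K4 G H].

Definition reducible (H : gain_multigraph) : Prop :=
  exists G, [/\ is_gain_graph G, tight22 G, (#|vertex G| < #|vertex H|)%N
      & gained_move G H].

Definition reduct (H : gain_multigraph) (S : {set vertex H}) (D : {set edge H})
    (lab : edge H -> gain_label {x | x \notin S}) : gain_multigraph :=
  @GainMultigraph {x | x \notin S} {e | e \notin D} (fun e => lab (val e)).

(* S is collapsed onto the vertex w0, which lies outside S *)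
Definition collapse (V : finType) (S : {set V}) (w0 : {x | x \notin S}) (x : V) :
  {x | x \notin S} := insubd w0 x.

Lemma val_collapse (V : finType) (S : {set V}) (w0 : {x | x \notin S}) (x : V) :
  val (collapse w0 x) = if x \in S then val w0 else x.
Proof. by rewrite val_insubd if_neg. Qed.

Lemma card_compl_sig (T : finType) (S : {set T}) :
  (#|{: {x | x \notin S}}| + #|S| = #|T|)%N.
Proof.
rewrite -(cardC (mem S)) addnC card_sig; congr (_ + _)%N.
Qed.

Lemma reduct_gain (H : gain_multigraph) (S : {set vertex H}) (D : {set edge H})
    (lab : edge H -> gain_label {x | x \notin S}) :
  (forall e f, e \notin D -> f \notin D -> same_label (lab e) (lab f) -> e = f) ->
  (forall e, e \notin D -> (lab e).1.1 != (lab e).1.2) ->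
  is_gain_graph (reduct D lab).
Proof.
move=> labI labN; split=> [[e eD] [f fD] u v g eE fE|[e eD] v].
  apply: val_inj; apply: labI => //; apply: same_label_trans eE _.
  exact: same_label_sym.
by have := labN e eD; rewrite /is_edge /same_label /= => /eqP + [] E; rewrite E.
Qed.

Lemma card_induced_reduct (H : gain_multigraph) (S : {set vertex H})
    (D : {set edge H}) (lab : edge H -> gain_label {x | x \notin S}) A :
  #|induced (@label (reduct D lab)) A| = #|induced lab A :\: D|.
Proof.
rewrite -(card_imset _ val_inj); apply: eq_card=> f.
apply/imsetP/idP=> [[[x xD] xA ->]|fB].
  by rewrite in_setD inE; move: xA; rewrite inE /= => ->; rewrite xD.
move: fB; rewrite in_setD inE => /andP[fD fB].
by exists (Sub f fD); rewrite ?SubK // inE /=.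
Qed.

Lemma reduct_tight (H : gain_multigraph) (S : {set vertex H})
    (D : {set edge H}) (lab : edge H -> gain_label {x | x \notin S}) :
  tight22 H -> (#|D| = 2 * #|S|)%N ->
  (forall A : {set {x | x \notin S}}, A != set0 ->
     #|induced lab A :\: D| + 2 <= 2 * #|A|)%N ->
  tight22 (reduct D lab).
Proof.
move=> /tight22E[cE _] cD spL; apply/tight22E; split=> /=.
  apply/eqP; rewrite -(eqn_add2r (2 * #|S|)) -mulnDr card_compl_sig -cE addnAC.
  by rewrite -cD card_compl_sig.
by move=> A A0; rewrite card_induced_reduct; apply: spL.
Qed.

Lemma card_preim_collapse (V : finType) (S : {set V}) (w0 : {x | x \notin S})
    (A : {set {x | x \notin S}}) :
  #|collapse w0 @^-1: A| = (#|A| + (w0 \in A) * #|S|)%N.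
Proof.
have -> : collapse w0 @^-1: A = val @: A :|: (if w0 \in A then S else set0).
  apply/setP=> x; rewrite !inE; case: (boolP (x \in S)) => xS.
    have -> : collapse w0 x = w0 by apply: val_inj; rewrite val_collapse xS.
    have -> : (x \in val @: A) = false.
      by apply/imsetP=> -[y _ xy]; have := valP y; rewrite -xy xS.
    by case: ifP; rewrite ?xS ?inE.
  have -> : collapse w0 x = Sub x xS.
    by apply: val_inj; rewrite val_collapse (negPf xS).
  have -> : (x \in (if w0 \in A then S else set0)) = false.
    by case: ifP; rewrite ?(negPf xS) ?inE.
  rewrite orbF -(mem_imset (mem A) _ val_inj) SubK; exact.
have := cardsUI (val @: A) (if w0 \in A then S else set0).
rewrite (_ : _ :&: _ = set0) ?cards0 ?addn0 => [->|].
  by rewrite card_imset; [case: ifP; rewrite ?mul1n ?cards0 | exact: val_inj].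
apply/setP=> x; rewrite !inE; apply/andP=> -[/imsetP[y _ ->]].
by case: ifP; rewrite ?inE // (negPf (valP y)).
Qed.

Lemma no_loop_label (H : gain_multigraph) (e : edge H) :
  sparse H -> (label e).1.1 != (label e).1.2.
Proof.
move=> spH; apply: (@sparse_no_loop _ e _ _ (label e).2 spH).
by left; case: (label e) => [[]].
Qed.

Lemma notin_incident (H : gain_multigraph) (e : edge H) x :
  e \notin incident x -> ~~ ((label e).1.1 \in [set x]) /\ ~~ ((label e).1.2 \in [set x]).
Proof. by rewrite !inE negb_or => /andP. Qed.

Lemma map_collapseK (V : finType) (S : {set V}) (w0 : {x | x \notin S})
    (l : gain_label V) :
  l.1.1 \notin S -> l.1.2 \notin S ->
  map_label val (map_label (collapse w0) l) = l.
Proof.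
move: l => [[x y] g] /= xS yS.
by rewrite /map_label /= !val_collapse (negPf xS) (negPf yS).
Qed.

Lemma inside_collapse (V : finType) (S : {set V}) (w0 : {x | x \notin S})
    (A : {set {x | x \notin S}}) (l : gain_label V) :
  l.1.1 \notin S -> l.1.2 \notin S ->
  inside A (map_label (collapse w0) l) = inside (val @: A) l.
Proof.
move=> xS yS; rewrite -[in RHS](map_collapseK w0 xS yS) /inside /=.
by rewrite !mem_imset //; apply: val_inj.
Qed.

Definition point_out (V : finType) (v : V) (o : option {x | x \notin [set v]}) : V :=
  if o is Some x then val x else v.

Lemma point_out_inj (V : finType) (v : V) : injective (@point_out V v).
Proof.
move=> [x|] [y|] //= xy; first by congr Some; apply: val_inj.
  by have := valP x; rewrite /= xy !inE eqxx.
by have := valP y; rewrite /= -xy !inE eqxx.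
Qed.

Lemma card_point_out (V : finType) (v : V) :
  #|V| = #|{: option {x | x \notin [set v]}}|.
Proof. by rewrite card_option -addn1 -(cards1 v) card_compl_sig. Qed.

Lemma card_lt_reduct (V : finType) (S : {set V}) :
  S != set0 -> (#|{: {x | x \notin S}}| < #|V|)%N.
Proof. by rewrite -card_gt0 -(card_compl_sig S); lia. Qed.

Lemma set1_neq0 (T : finType) (x : T) : [set x] != set0.
Proof. by apply/set0Pn; exists x; rewrite inE. Qed.

Lemma zero_reduction (H : gain_multigraph) (v a b : vertex H) (e1 e2 : edge H)
    ga gb :
  is_gain_graph H -> tight22 H -> e1 != e2 -> incident v = [set e1; e2] ->
  is_edge e1 v a ga -> is_edge e2 v b gb -> reducible H.
Proof.
move=> gH tH e12 incE eE1 eE2; have /tight22E[_ spH] := tH.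
have av : a \notin [set v] by rewrite inE eq_sym (sparse_no_loop spH eE1).
have bv : b \notin [set v] by rewrite inE eq_sym (sparse_no_loop spH eE2).
pose w0 : {x | x \notin [set v]} := Sub a av.
pose lab e := map_label (collapse w0) (label e : gain_label (vertex H)).
have labK e : e \notin incident v -> map_label val (lab e) = label e.
  by case/notin_incident=> *; apply: map_collapseK.
exists (reduct (incident v) lab); split.
- apply: reduct_gain=> [e f eD fD /(same_label_map val)|e eD].
    by rewrite !labK //; apply: gain_graph_inj.
  have := no_loop_label e spH; rewrite -(labK e eD).
  by apply: contraNneq => /= ->.
- apply: reduct_tight => //; first by rewrite incE cards1 cards2 e12.
  move=> A A0; rewrite -(card_imset (mem A) val_inj).
  have /spH : val @: A != set0 by rewrite imset_eq0.
  apply: leq_trans; rewrite leq_add2r; apply/subset_leq_card/subsetP=> e.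
  rewrite in_setD => /andP[/notin_incident[? ?]].
  by rewrite !inE /lab inside_collapse.
- exact/card_lt_reduct/set1_neq0.
apply: Or41; exists w0, (Sub b bv), ga, gb.
apply: (gain_iso_add_edges (theta := @point_out _ v)) => //.
- exact: point_out_inj.
- exact: card_point_out.
- by rewrite /= -(card_compl_sig (incident v)) incE cards2 e12.
move=> e; case: (boolP (e \in incident v)) => [|eD]; last first.
  by left; exists (Sub e eD); left; rewrite -[LHS](labK e eD).
rewrite incE !inE => /orP[]/eqP->; right.
- by exists (None, Some w0, ga); rewrite ?inE ?eqxx.
- by exists (None, Some (Sub b bv), gb); rewrite ?inE ?eqxx ?orbT.
Qed.

Lemma one_reduction (H : gain_multigraph) (v a b c : vertex H)
    (e1 e2 e3 : edge H) ga gb gc :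
  is_gain_graph H -> tight22 H -> uniq [:: e1; e2; e3] ->
  incident v = [set e1; e2; e3] ->
  is_edge e1 v a ga -> is_edge e2 v b gb -> is_edge e3 v c gc -> a != b ->
  (forall A, tight_set A -> a \in A -> b \in A -> v \in A) ->
  (forall f, ~ is_edge f a b (gb - ga)) -> reducible H.
Proof.
move=> gH tH eU incE eE1 eE2 eE3 ab tA nab; have /tight22E[_ spH] := tH.
have av : a \notin [set v] by rewrite inE eq_sym (sparse_no_loop spH eE1).
have bv : b \notin [set v] by rewrite inE eq_sym (sparse_no_loop spH eE2).
have cv : c \notin [set v] by rewrite inE eq_sym (sparse_no_loop spH eE3).
have [e12 e13 e23] : [/\ e1 != e2, e1 != e3 & e2 != e3].
  by move: eU; rewrite /= !inE negb_or => /and3P[/andP[]].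
pose w0 : {x | x \notin [set v]} := Sub a av.
pose wb : {x | x \notin [set v]} := Sub b bv.
pose D := [set e2; e3].
have cD : #|D| = 2%N by rewrite cards2 e23.
have incD e : e \notin D -> e != e1 -> e \notin incident v.
  by rewrite incE !inE => /norP[/negPf-> /negPf->] /negPf->.
pose lab e : gain_label _ := if e == e1 then (w0, wb, gb - ga)
  else map_label (collapse w0) (label e : gain_label (vertex H)).
have lab1 : map_label val (lab e1) = (a, b, gb - ga) by rewrite /lab eqxx.
have labK e : e \notin D -> e != e1 -> map_label val (lab e) = label e.
  move=> eD ee1; rewrite /lab (negPf ee1).
  by have [? ?] := notin_incident (incD e eD ee1); apply: map_collapseK.
have e1D : e1 \notin D by rewrite !inE negb_or e12.
exists (reduct D lab); split.
- apply: reduct_gain=> [e f eD fD /(same_label_map val)|e eD].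
    case: (eqVneq e e1) => [->|ee1]; case: (eqVneq f e1) => [->|fe1] //.
    + by rewrite lab1 labK // => /same_label_sym/nab.
    + by rewrite lab1 labK // => /nab.
    + by rewrite !labK //; apply: gain_graph_inj.
  case: (eqVneq e e1) => [->|ee1].
    by apply: contraNneq ab; rewrite /lab eqxx /= => /(congr1 val) /= ->.
  have := no_loop_label e spH; rewrite -(labK e eD ee1).
  by apply: contraNneq => /= ->.
- apply: reduct_tight => //; first by rewrite cards1 cD.
  move=> A A0; pose B := val @: A.
  have cB : #|A| = #|B| by rewrite card_imset //; apply: val_inj.
  have B0 : B != set0 by rewrite imset_eq0.
  have vB : v \notin B.
    by apply/imsetP=> -[x _ vx]; have := valP x; rewrite -vx !inE eqxx.
  have sub : induced lab A :\: D :\ e1 \subset induced (@label H) B.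
    apply/subsetP=> e; rewrite !in_setD1 in_setD => /and3P[ee1 eD].
    have [? ?] := notin_incident (incD e eD ee1).
    by rewrite !inE /lab (negPf ee1) inside_collapse.
  have := subset_leq_card sub; have := cardsD1 e1 (induced lab A :\: D).
  have := spH B B0; rewrite cB.
  case: (boolP (tight_set B)) => [tB|]; last first.
    by rewrite /tight_set B0 /=; clear; lia.
  have -> : (e1 \in induced lab A :\: D) = false; last by clear; lia.
  rewrite in_setD [e1 \in induced _ _]inE /lab eqxx /inside /=.
  apply/negP=> /and3P[_ aA bA].
  move/negP: vB; apply; apply: tA => //.
    by apply/imsetP; exists w0.
  by apply/imsetP; exists wb.
- exact/card_lt_reduct/set1_neq0.
apply: Or42; exists (Sub e1 e1D), w0, wb, (Sub c cv), (gb - ga), ga, gb, gc.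
split=> //; first by left; rewrite /= /lab eqxx.
apply: (gain_iso_add_edges (theta := @point_out _ v)) => //.
- exact: point_out_inj.
- exact: card_point_out.
- rewrite [size _]/= -(card_compl_sig D) cD -addn1 addnCA addnC.
  by rewrite -[X in _ = (X + _)%N](card_sig_neq (Sub e1 e1D : {e | e \notin D})) -addnA.
move=> e; case: (eqVneq e e1) => [->|ee1].
  by right; exists (None, Some w0, ga); rewrite ?inE ?eqxx.
case: (boolP (e \in D)) => [|eD]; last first.
  have ne : (Sub e eD : {e | e \notin D}) != Sub e1 e1D by [].
  left; exists (Sub (Sub e eD : edge (reduct D lab)) ne); left.
  by rewrite -[LHS](labK e eD ee1).
rewrite !inE => /orP[]/eqP->; right.
- by exists (None, Some wb, gb); rewrite ?inE ?eqxx ?orbT.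
- by exists (None, Some (Sub c cv), gc); rewrite ?inE ?eqxx ?orbT.
Qed.

Lemma kept_or_moved_collapse (V : finType) (S : {set V})
    (w0 : {x | x \notin S}) (V' : Type) (i : {x | x \notin S} -> V')
    (rho : V -> V') (N : V' -> Prop) (l : gain_label V) :
  (forall x, x \notin S -> rho x = i (collapse w0 x)) ->
  (forall x, x \in S -> N (rho x)) -> ~~ inside S l ->
  kept_or_moved i w0 N (map_label (collapse w0) l) (map_label rho l).
Proof.
move=> rhoS rhoN; move: l => [[x y] g]; rewrite /inside /= negb_and.
have cS z : z \in S -> collapse w0 z = w0.
  by move=> zS; apply: val_inj; rewrite val_collapse zS.
case: (boolP (x \in S)) => [xS yS|xS].
  right; exists (collapse w0 y), g, (rho x); split; [|exact: rhoN|].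
    by left; rewrite /map_label /= (cS x xS).
  by left; rewrite /map_label /= -(rhoS y yS).
case: (boolP (y \in S)) => [yS _|yS _]; last first.
  by left; left; rewrite /map_label /= (rhoS x xS) (rhoS y yS).
right; exists (collapse w0 x), (- g), (rho y); split; [|exact: rhoN|].
  by right; rewrite /map_label /= opprK (cS y yS).
by right; rewrite /map_label /= opprK -(rhoS x xS).
Qed.

Lemma double_edge_tight (H : gain_multigraph) (e f : edge H) p q g h :
  e != f -> is_edge e p q g -> is_edge f p q h -> tight_set [set p; q].
Proof.
move=> ef eE fE; apply/andP; split; first by apply/set0Pn; exists p; rewrite !inE eqxx.
have : [set e; f] \subset induced (@label H) [set p; q].
  apply/subsetP=> x; rewrite in_set2 => /orP[]/eqP->.
    by rewrite (inside_edge _ eE) !inE !eqxx orbT.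
  by rewrite (inside_edge _ fE) !inE !eqxx orbT.
move=> /subset_leq_card; rewrite !cards2 ef.
by case: (p != q); move=> /=; clear; lia.
Qed.

Lemma K3_reduction (H : gain_multigraph) (v0 v1 v2 : vertex H)
    (e01 e02 e12 : edge H) g1 g2 :
  is_gain_graph H -> tight22 H -> is_edge e01 v0 v1 g1 -> is_edge e02 v0 v2 g2 ->
  is_edge e12 v1 v2 (g2 - g1) ->
  (forall A, tight_set A -> v0 \in A -> v1 \in A -> v2 \in A) ->
  (forall f f' u g, is_edge f v0 u g -> is_edge f' v1 u g -> f = e02) ->
  reducible H.
Proof.
move=> gH tH e01E e02E e12E tA confl; have /tight22E[_ spH] := tH.
have v01 := sparse_no_loop spH e01E; have v02 := sparse_no_loop spH e02E.
have v12 := sparse_no_loop spH e12E.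
have v1S : v1 \notin [set v0] by rewrite inE eq_sym.
have v2S : v2 \notin [set v0] by rewrite inE eq_sym.
pose w0 : {x | x \notin [set v0]} := Sub v1 v1S.
pose w2 : {x | x \notin [set v0]} := Sub v2 v2S.
have e0102 : e01 != e02.
  by apply: contraNneq v12 => E; rewrite -E in e02E; rewrite (is_edge_end e01E e02E).
pose D := [set e01; e02].
have cD : #|D| = 2%N by rewrite cards2 e0102.
have colE x y : collapse w0 x = collapse w0 y ->
    [\/ x = y, x = v0 /\ y = v1 | x = v1 /\ y = v0].
  move=> /(congr1 val); rewrite !val_collapse !inE /=.
  case: eqP => [->|_]; case: eqP => [->|_] E; [exact: Or31 | | | exact: Or31].
    by apply: Or32; rewrite -E.
  by apply: Or33; rewrite E.
have cv0 : collapse w0 v0 = w0.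
  by apply: val_inj; rewrite val_collapse inE eqxx.
have cv1 : collapse w0 v1 = w0.
  by apply: val_inj; rewrite val_collapse (negPf v1S).
have colN x y : collapse w0 x = collapse w0 y -> x != y -> collapse w0 x = w0.
  by move=> /colE[->|[-> _]|[-> _]] //; rewrite eqxx.
have noloop e x y g : e \notin D -> is_edge e x y g -> collapse w0 x != collapse w0 y.
  have par f h : f \notin D -> ~ is_edge f v0 v1 h.
    move=> fD fE; have ef : f != e01 by apply: contraNneq fD => ->; rewrite !inE eqxx.
    have := tA _ (double_edge_tight ef fE e01E).
    rewrite !inE !eqxx orbT => /(_ isT isT) /orP[]/eqP E.
      by rewrite E eqxx in v02.
    by rewrite E eqxx in v12.
  move=> eD eE; apply/eqP=> /colE[xy|[xE yE]|[xE yE]].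
  - by have := sparse_no_loop spH eE; rewrite xy eqxx.
  - by apply: (par e g eD); rewrite -xE -yE.
  - by apply: (par e (- g) eD); apply: is_edge_rev; rewrite -xE -yE.
pose lab e := map_label (collapse w0) (label e : gain_label (vertex H)).
have labE (e : edge H) : is_edge e (label e).1.1 (label e).1.2 (label e).2.
  by left; case: (label e) => [[]].
have e02D : e02 \in D by rewrite !inE eqxx orbT.
have e12D : e12 \notin D.
  rewrite !inE; apply/norP; split; apply/eqP => E; move: e12E; rewrite E => e12E.
    by rewrite (is_edge_end (is_edge_rev e01E) e12E) eqxx in v02.
  by rewrite (is_edge_end (is_edge_rev e02E) (is_edge_rev e12E)) eqxx in v01.
exists (reduct D lab); split.
- apply: reduct_gain=> [e f eD fD /same_label_mapK|e eD];
  last exact: (noloop _ _ _ _ eD (labE e)).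
  case=> x [y [x' [y' [g [eE fE rx ry]]]]].
  have key a b z z' u h : a \notin D -> b \notin D -> is_edge a z u h ->
      is_edge b z' u h -> collapse w0 z = collapse w0 z' -> a = b.
    move=> aD bD aE bE /colE[zz|[Ez Ez']|[Ez Ez']].
    - by case: gH => uniqH _; apply: uniqH bE; rewrite -zz.
    - by rewrite Ez Ez' in aE bE; move: aD; rewrite (confl _ _ _ _ aE bE) e02D.
    - by rewrite Ez Ez' in aE bE; move: bD; rewrite (confl _ _ _ _ bE aE) e02D.
  case: (eqVneq y y') => [yy|yy].
    by rewrite -yy in fE; apply: (key _ _ _ _ _ _ eD fD eE fE).
  case: (eqVneq x x') => [xx|xx].
    rewrite -xx in fE.
    by apply: (key _ _ _ _ _ _ eD fD (is_edge_rev eE) (is_edge_rev fE)).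
  have := noloop _ _ _ _ eD eE.
  by rewrite (colN _ _ rx xx) (colN _ _ ry yy) eqxx.
- apply: reduct_tight => //; first by rewrite cards1 cD.
  move=> A A0; pose B := collapse w0 @^-1: A.
  have indE : induced lab A = induced (@label H) B.
    by apply/setP=> e; rewrite !inE inside_preim.
  have cB : #|B| = (#|A| + (w0 \in A))%N by rewrite card_preim_collapse cards1 muln1.
  have memB x : (x \in B) = (collapse w0 x \in A) by rewrite inE.
  have v0B : (v0 \in B) = (w0 \in A).
    by rewrite memB cv0.
  have v1B : (v1 \in B) = (w0 \in A).
    by rewrite memB cv1.
  have B0 : B != set0.
    by rewrite -card_gt0 cB; move: A0; rewrite -card_gt0; clear; lia.
  have := spH B B0; rewrite indE cB; have := cardsID D (induced (@label H) B).
  case w0A : (w0 \in A); last by clear; lia.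
  case: (boolP (v2 \in B)) => v2B.
    have /setIidPr-> : D \subset induced (@label H) B.
      apply/subsetP=> e; rewrite in_set2 => /orP[]/eqP->.
        by rewrite (inside_edge _ e01E) v0B v1B w0A.
      by rewrite (inside_edge _ e02E) v0B v2B w0A.
    by rewrite cD; clear; lia.
  have : ~~ tight_set B.
    by apply: contraNN v2B => tB; apply: tA; rewrite ?v0B ?v1B ?w0A.
  have : (0 < #|induced (@label H) B :&: D|)%N.
    apply/card_gt0P; exists e01; rewrite in_setI (inside_edge _ e01E) v0B v1B w0A.
    by rewrite !inE eqxx.
  by rewrite /tight_set B0 cB w0A /=; clear; lia.
- exact/card_lt_reduct/set1_neq0.
apply: Or43.
pose rho : vertex H -> option {x | x \notin [set v0]} := insub.
have rhoS x : x \notin [set v0] -> rho x = Some (collapse w0 x).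
  move=> xS; rewrite /rho insubT; congr Some.
  by apply: val_inj; rewrite val_collapse (negPf xS).
have rhoK x : point_out (rho x) = x.
  rewrite /rho; case: insubP => [y _ //|]; rewrite negbK inE => /eqP->; exact: erefl.
exists (Sub e12 e12D), w0, w2, (g2 - g1), g1, g2.
exists (fun f => map_label rho (label (val f))); split=> //.
- have := same_label_map (collapse w0) e12E.
  rewrite /map_label /= cv1; congr same_label; congr (_, _, _).
  by apply: val_inj; rewrite val_collapse (negPf v2S).
- rewrite /= /lab /map_label /= !rhoS //.
    case: e12E => -> /=; by [].
  case: e12E => -> /=; by [].
- move=> f _; apply: kept_or_moved_collapse => // [x xS|].
    by rewrite /rho insubN // negbK.
  rewrite /inside !inE; apply/negP=> /andP[/eqP E1 /eqP E2].
  by have := no_loop_label (val f) spH; rewrite E1 E2 eqxx.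
apply: (gain_iso_add_edges (theta := @point_out _ v0)) => //.
- exact: point_out_inj.
- exact: card_point_out.
- by rewrite /= -(card_compl_sig D) cD.
move=> e; case: (boolP (e \in D)) => [|eD]; last first.
  left; exists (Sub e eD); left.
  by case: (label e) => [[x y] g]; rewrite /map_label /= !rhoK.
rewrite !inE => /orP[]/eqP->; right.
- by exists (None, Some w0, g1); rewrite ?inE ?eqxx.
- by exists (None, Some w2, g2); rewrite ?inE ?eqxx ?orbT.
Qed.

Lemma clique4_simple (H : gain_multigraph) (K : {set vertex H}) (e f : edge H)
    p q g h :
  sparse H -> clique K -> #|K| = 4%N -> p \in K -> q \in K ->
  is_edge e p q g -> is_edge f p q h -> e = f.
Proof.
move=> spH cK K4 pK qK eE fE; apply/eqP/idPn => ef.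
have tpq := double_edge_tight ef eE fE.
have := clique4_sub spH cK K4 tpq _ _ (sparse_no_loop spH eE).
rewrite !inE !eqxx pK qK orbT => /(_ isT isT)/subset_leq_card.
by rewrite K4 cards2; case: (p != q).
Qed.

Lemma K4_reduction (H : gain_multigraph) (x0 a b c : vertex H) :
  is_gain_graph H -> tight22 H -> uniq [:: x0; a; b; c] ->
  (forall p q, p \in [:: x0; a; b; c] -> q \in [:: x0; a; b; c] -> p != q ->
     exists e, is_edge e p q 0) ->
  (forall f f' p q u g, p \in [:: x0; a; b; c] -> q \in [:: x0; a; b; c] ->
     u \notin [:: x0; a; b; c] -> is_edge f p u g -> is_edge f' q u g -> p = q) ->
  reducible H.
Proof.
move=> gH tH Ku edgeK confl; have /tight22E[_ spH] := tH.
pose K := [set x in [:: x0; a; b; c]].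
have memK x : (x \in [:: x0; a; b; c]) = (x \in K) by rewrite [x \in K]inE.
have K4 : #|K| = 4%N by rewrite cardsE (card_uniqP Ku).
have cK : clique K.
  apply/cliqueP=> p q; rewrite -!memK => pK qK pq.
  by have [e eE] := edgeK p q pK qK pq; apply/joinedP; exists e, 0.
pose S := [set x in [:: a; b; c]].
have Su : uniq [:: a; b; c] by case/andP: Ku.
have cS : #|S| = 3%N.
  by rewrite cardsE (card_uniqP Su).
have x0S : x0 \notin S by rewrite inE; case/andP: Ku.
have KE x : (x \in K) = (x == x0) || (x \in S) by rewrite [x \in K]inE in_cons [x \in S]inE.
pose w0 : {x | x \notin S} := Sub x0 x0S.
pose D := induced (@label H) K.
have cD : #|D| = 6%N.
  have := clique_induced cK; have := clique4_tight cK K4.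
  move=> /andP[K0 _]; have := spH K K0.
  by rewrite K4 (_ : 'C(4, 2) = 6)%N //= -/D; clear; lia.
have cvK x : x \in K -> collapse w0 x = w0.
  move=> xK; apply: val_inj; rewrite val_collapse; case: ifP => // xS.
  by move: xK; rewrite KE xS orbF => /eqP.
have colE x y : collapse w0 x = collapse w0 y -> x = y \/ x \in K /\ y \in K.
  move=> /(congr1 val); rewrite !val_collapse !KE.
  case: (boolP (x \in S)) => xS; case: (boolP (y \in S)) => yS /=; rewrite ?orbT ?orbF.
  - by right.
  - by move=> <-; right.
  - by move=> ->; right.
  - by left.
have noloop e x y g : e \notin D -> is_edge e x y g -> collapse w0 x != collapse w0 y.
  move=> eD eE; apply/eqP=> /colE[xy|[xK yK]].
    by have := sparse_no_loop spH eE; rewrite xy eqxx.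
  by rewrite (inside_edge _ eE) xK yK in eD.
pose lab e := map_label (collapse w0) (label e : gain_label (vertex H)).
have labE (e : edge H) : is_edge e (label e).1.1 (label e).1.2 (label e).2.
  by left; case: (label e) => [[]].
exists (reduct D lab); split.
- apply: reduct_gain=> [e f eD fD /same_label_mapK|e eD];
    last exact: (noloop _ _ _ _ eD (labE e)).
  case=> x [y [x' [y' [g [eE fE rx ry]]]]].
  have key z z' u h : is_edge e z u h -> is_edge f z' u h ->
      collapse w0 z = collapse w0 z' -> e = f.
    move=> eE' fE' zz; case: gH => uniqH _.
    have [E|[zK zK']] := colE _ _ zz; first by apply: uniqH fE'; rewrite -E.
    have uK : u \notin K.
      by move: eD; rewrite (inside_edge _ eE') zK.
    have E : z = z' by apply: (confl e f z z' u h) => //; rewrite memK.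
    by apply: uniqH fE'; rewrite -E.
  case: (eqVneq y y') => [yy|yy]; first by rewrite -yy in fE; apply: (key _ _ _ _ eE fE).
  case: (eqVneq x x') => [xx|xx].
    by rewrite -xx in fE; apply: (key _ _ _ _ (is_edge_rev eE) (is_edge_rev fE)).
  have := noloop _ _ _ _ eD eE.
  have [E|[xK _]] := colE _ _ rx; first by rewrite E eqxx in xx.
  have [E|[yK _]] := colE _ _ ry; first by rewrite E eqxx in yy.
  by rewrite !cvK ?eqxx.
- apply: reduct_tight => //; first by rewrite cS cD.
  move=> A A0; pose B := collapse w0 @^-1: A.
  have indE : induced lab A = induced (@label H) B.
    by apply/setP=> e; rewrite !inE inside_preim.
  have cB : #|B| = (#|A| + (w0 \in A) * 3)%N by rewrite card_preim_collapse cS.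
  have B0 : B != set0.
    by rewrite -card_gt0 cB; move: A0; rewrite -card_gt0; clear; lia.
  have := spH B B0; rewrite indE cB; have := cardsID D (induced (@label H) B).
  case w0A : (w0 \in A); last by clear; lia.
  have /setIidPr-> : D \subset induced (@label H) B.
    apply: subset_induced; apply/subsetP=> x xK.
    by rewrite inE cvK.
  by rewrite cD; clear; lia.
- by apply: card_lt_reduct; rewrite -card_gt0 cS.
apply: Or44.
pose s := [:: a; b; c].
pose theta (z : {x | x \notin S} + 'I_3) : vertex H :=
  match z with inl x => val x | inr j => nth x0 s j end.
have sS (j : 'I_3) : nth x0 s j \in S by rewrite inE mem_nth.
pose rho x : {x | x \notin S} + 'I_3 :=
  if insub x is Some w then inl w else inr (inord (index x s)).
have rhoS x : x \notin S -> rho x = inl (collapse w0 x).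
  move=> xS; rewrite /rho insubT; congr inl.
  by apply: val_inj; rewrite val_collapse (negPf xS).
have rhoK x : theta (rho x) = x.
  rewrite /rho; case: insubP => [y _ //|]; rewrite negbK inE => xs.
  by rewrite /= inordK ?nth_index //; move: xs; rewrite -index_mem.
exists w0, (fun f => map_label rho (label (val f))); split.
  move=> f; apply: kept_or_moved_collapse => // [x xS|].
    by exists (inord (index x s)); rewrite /rho insubN // negbK.
  have := valP f; apply: contraNN; rewrite [_ \in D]inE /inside !KE.
  by case/andP=> -> ->; rewrite !orbT.
apply: (gain_iso_add_edges (theta := theta)) => //.
- move=> [x|i] [y|j] /= E.
  + by congr inl; apply: val_inj.
  + by have := valP x; rewrite /= E sS.
  + by have := valP y; rewrite /= -E sS.
  congr inr; apply: val_inj; apply/eqP.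
  have := nth_uniq x0 (ltn_ord i : i < size s)%N (ltn_ord j : j < size s)%N Su.
  by rewrite E eqxx => <-.
- by rewrite card_sum card_ord -(card_compl_sig S) cS.
- by rewrite /= -(card_compl_sig D) cD.
move=> e; case: (boolP (e \in D)) => [eD|eD]; last first.
  left; exists (Sub e eD); left.
  by case: (label e) => [[x y] g]; rewrite /map_label /= !rhoK.
right; move: (eD) (labE e); rewrite inE /inside => /andP[].
set p := (label e).1.1; set q := (label e).1.2; move=> pK qK eE.
have [f fE] : exists f, is_edge f p q 0.
  by apply: edgeK; rewrite ?memK //; apply: sparse_no_loop eE.
have ef := clique4_simple spH cK K4 pK qK eE fE; rewrite -ef in fE.
have pq := sparse_no_loop spH eE.
set ls := [:: _; _; _; _; _; _].
suff [i ls_i [E|E]] : exists2 i, (i < 6)%N &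
    map_label theta (nth (inl w0, inl w0, 0) ls i) = (p, q, 0) \/
    map_label theta (nth (inl w0, inl w0, 0) ls i) = (q, p, 0).
- by exists (nth (inl w0, inl w0, 0) ls i); [exact: mem_nth | rewrite E].
- exists (nth (inl w0, inl w0, 0) ls i); first exact: mem_nth.
  by rewrite E -oppr0; apply: is_edge_rev.
move: pK qK pq; rewrite -!memK !inE => /or4P[]/eqP-> /or4P[]/eqP-> pq;
  rewrite ?eqxx // in pq.
- by exists 0%N; [|left].
- by exists 1%N; [|left].
- by exists 2%N; [|left].
- by exists 0%N; [|right].
- by exists 3%N; [|left].
- by exists 4%N; [|left].
- by exists 1%N; [|right].
- by exists 3%N; [|right].
- by exists 5%N; [|left].
- by exists 2%N; [|right].
- by exists 4%N; [|right].
- by exists 5%N; [|right].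
Qed.

(** * Vertices of degree 3 *)

Lemma tight_set1 (H : gain_multigraph) (x : vertex H) : tight_set [set x].
Proof. by rewrite /tight_set set1_neq0 cards1; clear; lia. Qed.

Lemma degree_ge2 (H : gain_multigraph) (v : vertex H) :
  tight22 H -> (1 < #|vertex H|)%N -> (1 < degree v)%N.
Proof.
move=> /tight22E[cE spH] V1.
have C1 : (#|[set~ v]| + 1 = #|vertex H|)%N.
  by rewrite -(cards1 v) addnC cardsC.
have /spH : [set~ v] != set0 by rewrite -card_gt0; move: C1 V1; clear; lia.
by have := degree_induced v; move: cE C1 V1; clear; lia.
Qed.

Lemma one_reduction_or_blocked (H : gain_multigraph) (v a b c : vertex H)
    (e1 e2 e3 : edge H) ga gb gc :
  is_gain_graph H -> tight22 H -> uniq [:: e1; e2; e3] ->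
  incident v = [set e1; e2; e3] ->
  is_edge e1 v a ga -> is_edge e2 v b gb -> is_edge e3 v c gc -> a != b ->
  [\/ reducible H, exists A, [/\ tight_set A, a \in A, b \in A & v \notin A]
    | exists f, is_edge f a b (gb - ga)].
Proof.
move=> gH tH eU incE eE1 eE2 eE3 ab.
case: (boolP [exists A, [&& tight_set A, a \in A, b \in A & v \notin A]]).
  by case/existsP=> A /and4P[*]; apply: Or32; exists A.
rewrite negb_exists => /forallP nA.
case: (boolP [exists f, edgeb f a b (gb - ga)]).
  by case/existsP=> f /edgebP fE; apply: Or33; exists f.
rewrite negb_exists => /forallP nf.
apply: Or31; apply: one_reduction eE1 eE2 eE3 ab _ _ => // [A tA aA bA|f /edgebP fE].
  by have := nA A; rewrite tA aA bA /= negbK.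
by have := nf f; rewrite fE.
Qed.

Lemma degree3_tight_set (H : gain_multigraph) (v a b c : vertex H)
    (e1 e2 e3 : edge H) ga gb gc (A : {set vertex H}) :
  sparse H -> uniq [:: e1; e2; e3] ->
  is_edge e1 v a ga -> is_edge e2 v b gb -> is_edge e3 v c gc ->
  tight_set A -> a \in A -> b \in A -> c \in A -> v \in A.
Proof.
move=> spH eU eE1 eE2 eE3 tA aA bA cA; apply/idPn=> vA.
have [] := @tight_set_edges H A [set x in [:: e1; e2; e3]] v spH tA vA.
  move=> f; rewrite !inE => /or3P[]/eqP->.
  - by exists a, ga.
  - by exists b, gb.
  - by exists c, gc.
by rewrite cardsE (card_uniqP eU).
Qed.

Lemma degree3_parallel (H : gain_multigraph) (v a c : vertex H)
    (e1 e2 e3 : edge H) ga gb gc :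
  is_gain_graph H -> tight22 H -> uniq [:: e1; e2; e3] ->
  incident v = [set e1; e2; e3] ->
  is_edge e1 v a ga -> is_edge e2 v a gb -> is_edge e3 v c gc ->
  reducible H.
Proof.
move=> gH tH eU incE eE1 eE2 eE3; have /tight22E[_ spH] := tH.
have tA := degree3_tight_set spH eU eE1 eE2 eE3.
have va := sparse_no_loop spH eE1; have vc := sparse_no_loop spH eE3.
have ac : a != c.
  apply/eqP=> ac; have := tA _ (tight_set1 a).
  by rewrite !inE -ac !eqxx (negPf va) => /(_ isT isT isT).
have U1 : uniq [:: e1; e3; e2].
  by move: eU; rewrite /= !inE !negb_or (eq_sym e3) !andbT andbAC
    => /andP[/andP[-> ->] ->].
have U2 : uniq [:: e2; e3; e1].
  move: eU; rewrite /= !inE !negb_or (eq_sym e2 e1) (eq_sym e3 e1) !andbT.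
  by case/andP=> /andP[-> ->] ->.
have I1 : incident v = [set e1; e3; e2] by rewrite incE setUAC.
have I2 : incident v = [set e2; e3; e1] by rewrite incE -setUA setUC.
case: (one_reduction_or_blocked gH tH U1 I1 eE1 eE3 eE2 ac) => //.
  by case=> A [/tA tA' aA cA]; rewrite tA'.
case=> f1 f1E; case: (one_reduction_or_blocked gH tH U2 I2 eE2 eE3 eE1 ac) => //.
  by case=> A [/tA tA' aA cA]; rewrite tA'.
case=> f2 f2E.
have f12 : f1 != f2.
  apply/eqP=> E; rewrite -E in f2E.
  have := is_edge_gain ac f1E f2E => /addrI/oppr_inj gab; rewrite -gab in eE2.
  case: gH => uniqH _; move: eU; rewrite /= !inE (uniqH _ _ _ _ _ eE1 eE2).
  by rewrite eqxx.
have := tA _ (double_edge_tight f12 f1E f2E).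
by rewrite !inE !eqxx orbT (negPf va) (negPf vc) => /(_ isT isT isT).
Qed.

Definition balanced (H : gain_multigraph) (K : {set vertex H})
    (pot : vertex H -> Z2) : Prop :=
  forall x y, x \in K -> y \in K -> x != y -> exists e, is_edge e x y (pot y - pot x).

Lemma balanced_clique (H : gain_multigraph) (K : {set vertex H}) pot :
  balanced K pot -> clique K.
Proof.
move=> bK; apply/cliqueP=> x y xK yK xy; apply/joinedP.
by have [e eE] := bK x y xK yK xy; exists e, (pot y - pot x).
Qed.

Lemma degree3_balanced (H : gain_multigraph) (v : vertex H) :
  is_gain_graph H -> tight22 H -> degree v = 3%N ->
  reducible H \/ exists (K : {set vertex H}) pot,
    [/\ #|K| = 4%N, v \in K & balanced K pot].
Proof.
move=> gH tH; have /tight22E[_ spH] := tH.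
rewrite /degree => d3.
case E: (enum (incident v)) (enum_uniq (incident v)) (cardE (incident v))
    => [|e1 [|e2 [|e3 [|]]]]; rewrite d3 // => eU _.
have incE : incident v = [set e1; e2; e3].
  by apply/setP=> e; rewrite -mem_enum E !inE orbA.
have [a [ga eE1]] : exists w g, is_edge e1 v w g by apply/incidentP; rewrite incE !inE eqxx.
have [b [gb eE2]] : exists w g, is_edge e2 v w g.
  by apply/incidentP; rewrite incE !inE eqxx orbT.
have [c [gc eE3]] : exists w g, is_edge e3 v w g.
  by apply/incidentP; rewrite incE !inE eqxx orbT.
have U1 : uniq [:: e1; e3; e2].
  by move: eU; rewrite /= !inE !negb_or (eq_sym e3) !andbT andbAC
    => /andP[/andP[-> ->] ->].
have U2 : uniq [:: e2; e3; e1].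
  move: eU; rewrite /= !inE !negb_or (eq_sym e2 e1) (eq_sym e3 e1) !andbT.
  by case/andP=> /andP[-> ->] ->.
have I1 : incident v = [set e1; e3; e2] by rewrite incE setUAC.
have I2 : incident v = [set e2; e3; e1] by rewrite incE -setUA setUC.
have [ab|ab] := eqVneq a b.
  by left; rewrite -ab in eE2; apply: degree3_parallel incE eE1 eE2 eE3.
have [ac|ac] := eqVneq a c.
  by left; rewrite -ac in eE3; apply: degree3_parallel I1 eE1 eE3 eE2.
have [bc|bc] := eqVneq b c.
  by left; rewrite -bc in eE3; apply: degree3_parallel I2 eE2 eE3 eE1.
have tA := degree3_tight_set spH eU eE1 eE2 eE3.
have va := sparse_no_loop spH eE1; have vb := sparse_no_loop spH eE2.
have vc := sparse_no_loop spH eE3.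
have third (A : {set vertex H}) x y z g h f f' :
    tight_set A -> x \in A -> y \in A -> v \notin A -> x != y ->
    v != z -> is_edge f x z g -> is_edge f' y z h ->
    exists2 B, tight_set B & [/\ x \in B, y \in B, z \in B & v \notin B].
  move=> t xA yA vA xy vz fE fE'; case: (boolP (z \in A)) => zA; first by exists A.
  exists (z |: A); last by rewrite !inE xA yA eqxx !orbT (negPf vz).
  have [] := @tight_set_joined H A [set x; y] z spH t zA.
  - by rewrite subUset !sub1set xA.
  - move=> s; rewrite in_set2 => /orP[]/eqP->; apply/joinedP.
      by exists f, (- g); apply: is_edge_rev.
    by exists f', (- h); apply: is_edge_rev.
  by move=> _; apply; rewrite cards2 xy.
have two (A B : {set vertex H}) x : tight_set A -> tight_set B -> x \in A ->
    x \in B -> v \notin A -> v \notin B ->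
    exists2 C, tight_set C & [/\ {subset A <= C}, {subset B <= C} & v \notin C].
  move=> t t' xA xB vA vB; exists (A :|: B); first exact: tight_setUI xA xB.
  by rewrite inE negb_or vA vB; split=> // z zA; rewrite inE zA ?orbT.
case: (one_reduction_or_blocked gH tH eU incE eE1 eE2 eE3 ab)
  => [|[A [t1 A1 A2 vA]]|[f1 f1E]]; first by left.
  case: (one_reduction_or_blocked gH tH U1 I1 eE1 eE3 eE2 ac)
    => [|[B [t2 B1 B2 vB]]|[f2 f2E]]; first by left.
    have [C /tA tC [sA sB vC]] := two A B a t1 t2 A1 B1 vA vB.
    by rewrite (tC (sA _ A1) (sA _ A2) (sB _ B2)) in vC.
  case: (one_reduction_or_blocked gH tH U2 I2 eE2 eE3 eE1 bc)
    => [|[B [t2 B1 B2 vB]]|[f3 f3E]]; first by left.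
    have [C /tA tC [sA sB vC]] := two A B b t1 t2 A2 B1 vA vB.
    by rewrite (tC (sA _ A1) (sA _ A2) (sB _ B2)) in vC.
  have [C /tA tC [C1 C2 C3 vC]] := third A a b c _ _ _ _ t1 A1 A2 vA ab vc f2E f3E.
  by move: vC; rewrite tC.
case: (one_reduction_or_blocked gH tH U1 I1 eE1 eE3 eE2 ac)
  => [|[A [t1 A1 A2 vA]]|[f2 f2E]]; first by left.
  case: (one_reduction_or_blocked gH tH U2 I2 eE2 eE3 eE1 bc)
    => [|[B [t2 B1 B2 vB]]|[f3 f3E]]; first by left.
    have [C /tA tC [sA sB vC]] := two A B c t1 t2 A2 B2 vA vB.
    by rewrite (tC (sA _ A1) (sB _ B1) (sB _ B2)) in vC.
  have [C /tA tC [C1 C2 C3 vC]] :=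
    third A a c b _ _ _ _ t1 A1 A2 vA ac vb f1E (is_edge_rev f3E).
  by move: vC; rewrite tC.
case: (one_reduction_or_blocked gH tH U2 I2 eE2 eE3 eE1 bc)
  => [|[A [t1 A1 A2 vA]]|[f3 f3E]]; first by left.
  have [C /tA tC [C1 C2 C3 vC]] :=
    third A b c a _ _ _ _ t1 A1 A2 vA bc va (is_edge_rev f1E) (is_edge_rev f2E).
  by move: vC; rewrite tC.
right; exists [set x in [:: v; a; b; c]].
exists (fun x => if x == a then ga else if x == b then gb else if x == c then gc else 0).
split.
- rewrite cardsE; apply: (card_uniqP (s := [:: v; a; b; c])).
  by rewrite /= !inE !negb_or va vb vc ab ac bc.
- by rewrite !inE eqxx.
have [av bv cv] : [/\ a != v, b != v & c != v] by split; rewrite eq_sym.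
have [ba ca cb] : [/\ b != a, c != a & c != b] by split; rewrite eq_sym.
move=> x y; rewrite !inE => /or4P[]/eqP-> /or4P[]/eqP->; rewrite ?eqxx // => _;
  rewrite ?(negPf va, negPf vb, negPf vc, negPf ba, negPf ca, negPf cb) ?subr0 ?sub0r.
- by exists e1.
- by exists e2.
- by exists e3.
- by exists e1; apply: is_edge_rev.
- by exists f1.
- by exists f2.
- by exists e2; apply: is_edge_rev.
- by exists f1; rewrite -opprB; apply: is_edge_rev.
- by exists f3.
- by exists e3; apply: is_edge_rev.
- by exists f2; rewrite -opprB; apply: is_edge_rev.
- by exists f3; rewrite -opprB; apply: is_edge_rev.
Qed.

(* Since the labels are kept by the contraction, v can be contracted into x
   inside K as soon as the gain of the edge vx is non-zero. *)
Lemma degree3_gain0 (H : gain_multigraph) (v : vertex H) (K : {set vertex H}) pot :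
  is_gain_graph H -> tight22 H -> degree v = 3%N -> #|K| = 4%N -> v \in K ->
  balanced K pot ->
  reducible H \/ (forall x y, x \in K -> y \in K -> x != y -> exists e, is_edge e x y 0).
Proof.
move=> gH tH d3 K4 vK bK; have /tight22E[_ spH] := tH.
have cK := balanced_clique bK.
case: (boolP [forall x in K, pot x == pot v]) => [/forall_inP potE|].
  right=> x y xK yK xy; have [e eE] := bK x y xK yK xy.
  exists e; move: eE; by rewrite (eqP (potE x xK)) (eqP (potE y yK)) subrr.
case/forall_inPn=> x xK xv; left.
have vx : v != x by apply: contraNneq xv => ->.
have /set0Pn[y] : K :\: [set v; x] != set0.
  rewrite -card_gt0; have := cardsID [set v; x] K.
  have := subset_leq_card (subsetIr K [set v; x]).
  by rewrite K4 cards2 vx; clear; lia.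
rewrite !inE negb_or => /andP[/andP[yv yx] yK].
have [vy xy] : v != y /\ x != y by split; rewrite eq_sym.
have [e01 e01E] := bK v x vK xK vx; have [e02 e02E] := bK v y vK yK vy.
have [e12 e12E] := bK x y xK yK xy.
have := @K3_reduction H v x y e01 e02 e12 (pot x - pot v) (pot y - pot v).
apply => // [|A tA vA xA|f f' u g fE f'E].
- by rewrite opprB addrA subrK.
- apply: (subsetP (clique4_sub (p := v) (q := x) spH cK K4 tA _ _ vx)) => //.
    by rewrite inE vA.
  by rewrite inE xA.
have uK : u \in K.
  apply/idPn=> uK; have := @degree_ge H v (u |: K :\ v).
  have := cardsD1 v K; rewrite vK K4 cardsU1 d3 !inE (negPf uK) andbF => K3 H4.
  suff /H4 : forall s, s \in u |: K :\ v -> joined v s by move: K3; clear; lia.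
  move=> s; rewrite !inE => /orP[/eqP->|/andP[sv sK]].
    by apply/joinedP; exists f, g.
  by move/cliqueP: cK; apply; rewrite // eq_sym.
have vu := sparse_no_loop spH fE; have xu := sparse_no_loop spH f'E.
have [f0 f0E] := bK v u vK uK vu; have [f1 f1E] := bK x u xK uK xu.
have E0 := clique4_simple spH cK K4 vK uK fE f0E.
have E1 := clique4_simple spH cK K4 xK uK f'E f1E.
rewrite -E0 in f0E; rewrite -E1 in f1E.
have g0 := is_edge_gain vu fE f0E; have := is_edge_gain xu f'E f1E.
by rewrite g0 => /addrI/oppr_inj E; rewrite E eqxx in xv.
Qed.

Definition conflict (H : gain_multigraph) (f f' : edge H) (p q u : vertex H) : bool :=
  has (fun g => edgeb f p u g && edgeb f' q u g) [:: (label f).2; - (label f).2].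

Lemma conflictP (H : gain_multigraph) (f f' : edge H) (p q u : vertex H) :
  reflect (exists g, is_edge f p u g /\ is_edge f' q u g) (conflict f f' p q u).
Proof.
apply: (iffP hasP) => [[g _ /andP[/edgebP fE /edgebP f'E]]|[g [fE f'E]]]; exists g => //.
  by rewrite !inE; case: fE => -> /=; rewrite ?opprK eqxx ?orbT.
by apply/andP; split; apply/edgebP.
Qed.

Lemma K4_conflict (H : gain_multigraph) (K : {set vertex H}) (w x y : vertex H)
    (ex ey exy : edge H) h :
  is_gain_graph H -> tight22 H -> #|K| = 4%N -> clique K ->
  x \in K -> y \in K -> w \notin K -> is_edge exy x y 0 ->
  is_edge ex x w h -> is_edge ey y w h ->
  reducible H \/ (5 <= degree x)%N.
Proof.
move=> gH tH K4 cK xK yK wK exyE exE eyE; have /tight22E[_ spH] := tH.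
have xy := sparse_no_loop spH exyE; have xw := sparse_no_loop spH exE.
have /cliqueP jK := cK.
case: (boolP [exists f, exists f', exists u, conflict f f' w x u && (f != ey)]); last first.
  move=> nconf; left.
  have := @K3_reduction H w x y ex ey exy (- h) (- h).
  apply => // [||| A tA wA xA| f f' u g fE f'E].
  - exact: is_edge_rev.
  - exact: is_edge_rev.
  - by rewrite subrr.
  - apply/idPn=> yA.
    have jxw s : s \in [set x; w] -> joined y s.
      rewrite in_set2 => /orP[]/eqP->; first by apply: jK; rewrite // eq_sym.
      by apply/joinedP; exists ey, h.
    have [] := tight_set_joined (S := [set x; w]) spH tA yA _ jxw.
      by rewrite subUset !sub1set xA.
    rewrite cards2 xw => _ /(_ erefl) tyA.
    have KyA : K \subset y |: A.
      by apply: (clique4_sub (p := x) (q := y) spH cK K4 tyA _ _ xy);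
        rewrite !inE ?eqxx ?xA ?orbT.
    have [] := tight_set_joined (S := K :\ y) spH tA yA.
    + apply/subsetP=> s; rewrite in_setD1 => /andP[sy sK].
      by have := subsetP KyA s sK; rewrite !inE (negPf sy).
    + by move=> s; rewrite in_setD1 => /andP[sy sK]; apply: jK; rewrite // eq_sym.
    by have := cardsD1 y K; rewrite yK K4; clear; lia.
  apply/eqP/idPn=> fey; case/existsP: nconf; exists f; apply/existsP; exists f'.
  by apply/existsP; exists u; rewrite fey andbT; apply/conflictP; exists g.
case/existsP=> f /existsP[f' /existsP[u /andP[/conflictP[g [fE f'E]] fey]]].
right; have wu := sparse_no_loop spH fE; have xu := sparse_no_loop spH f'E.
have exey : ex != ey.
  by apply: contraNneq xy => E; rewrite E in exE;
    rewrite (is_edge_end (is_edge_rev exE) (is_edge_rev eyE)).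
have fex : f != ex.
  apply: contraNneq xu => E; rewrite E in fE.
  by rewrite (is_edge_end (is_edge_rev exE) fE).
have uK : u \notin K.
  apply/negP=> uK.
  have [] := @tight_set_edges H K [set z in [:: f; ex; ey]] w spH (clique4_tight cK K4) wK.
    move=> z; rewrite !inE => /or3P[]/eqP->.
    + by exists u, g.
    + by exists x, (- h); split=> //; apply: is_edge_rev.
    + by exists y, (- h); split=> //; apply: is_edge_rev.
  rewrite cardsE (card_uniqP (_ : uniq [:: f; ex; ey])) //=.
  by rewrite !inE negb_or fex fey exey.
have <- : #|u |: (w |: K :\ x)| = 5%N.
  have := cardsD1 x K; rewrite xK K4 !cardsU1 !inE.
  by rewrite (negPf wK) (negPf uK) !andbF eq_sym (negPf wu) /=; clear; lia.
apply: degree_ge => s; rewrite !inE => /or3P[/eqP->|/eqP->|/andP[sx sK]].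
- by apply/joinedP; exists f', g.
- by apply/joinedP; exists ex, h.
- by apply: jK; rewrite // eq_sym.
Qed.

Definition heavy (H : gain_multigraph) (K : {set vertex H}) : bool :=
  [&& #|K| == 4, clique K & 2 <= #|[set x in K | 5 <= degree x]|]%N.

Lemma degree3_heavy (H : gain_multigraph) (v : vertex H) :
  is_gain_graph H -> tight22 H -> degree v = 3%N ->
  reducible H \/ exists2 K : {set vertex H}, heavy K & v \in K.
Proof.
move=> gH tH d3; have /tight22E[_ spH] := tH.
have [|[K [pot [K4 vK bK]]]] := degree3_balanced gH tH d3; first by left.
have cK := balanced_clique bK.
have [|zK] := degree3_gain0 gH tH d3 K4 vK bK; first by left.
case: (boolP [exists f, exists f', exists x in K, exists y in K, exists u,
    [&& x != y, u \notin K & conflict f f' x y u]]); last first.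
  move=> nconf; left.
  case E: (enum K) (enum_uniq K) (cardE K) => [|x0 [|a [|b [|c [|]]]]]; rewrite K4 // => Ku _.
  have memK x : (x \in [:: x0; a; b; c]) = (x \in K) by rewrite -E mem_enum.
  apply: (K4_reduction gH tH Ku) => [p q|f f' p q u g]; rewrite !memK; first exact: zK.
  move=> pK qK uK fE f'E; apply/eqP/idPn=> pq; case/existsP: nconf; exists f.
  apply/existsP; exists f'; apply/exists_inP; exists p => //.
  apply/exists_inP; exists q => //; apply/existsP; exists u; rewrite pq uK /=.
  by apply/conflictP; exists g.
case/existsP=> f /existsP[f' /exists_inP[x xK /exists_inP[y yK /existsP[u]]]].
case/and3P=> xy uK /conflictP[g [fE f'E]].
have [e eE] := zK x y xK yK xy.
have [|dx] := K4_conflict gH tH K4 cK xK yK uK eE fE f'E; first by left.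
have [e' e'E] : exists e, is_edge e y x 0 by apply: zK; rewrite // eq_sym.
have [|dy] := K4_conflict gH tH K4 cK yK xK uK e'E f'E fE; first by left.
right; exists K => //; rewrite /heavy K4 cK /=.
apply: (@leq_trans #|[set x; y]|); first by rewrite cards2 xy.
apply/subset_leq_card/subsetP=> z; rewrite !inE.
by case/orP=> /eqP->; rewrite ?xK ?yK.
Qed.

(* Two 4-cliques share at most one vertex, so those through x use disjoint
   triples of neighbours of x. *)
Lemma card_heavy_at (H : gain_multigraph) (x : vertex H) :
  sparse H -> (3 * #|[set K : {set vertex H} | heavy K & x \in K]| <= degree x)%N.
Proof.
move=> spH; set P := [set K : {set vertex H} | heavy K & x \in K].
pose nbr K := K :\ x.
have heavyP K : K \in P -> [/\ #|K| = 4%N, clique K & x \in K].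
  by rewrite inE => /andP[/and3P[/eqP ? ? _] ?].
have common K L y : K \in P -> L \in P -> y \in nbr K -> y \in nbr L -> K = L.
  move=> /heavyP[K4 cK xK] /heavyP[L4 cL xL].
  rewrite !in_setD1 => /andP[yx yK] /andP[_ yL].
  apply/eqP; rewrite eqEcard K4 L4 andbT.
  by apply: (clique4_sub spH cK K4 (clique4_tight cL L4) _ _ yx); rewrite inE ?xK ?xL ?yK ?yL.
have nbrI : {in P &, injective nbr}.
  move=> K L KP LP KL; have [K4 _ xK] := heavyP K KP.
  have /set0Pn[y yK] : nbr K != set0.
    by rewrite -card_gt0; have := cardsD1 x K; rewrite xK K4 /nbr; clear; lia.
  by apply: (common K L y) => //; rewrite -KL.
have tI : trivIset (nbr @: P).
  apply/trivIsetP=> _ _ /imsetP[K KP ->] /imsetP[L LP ->] KL.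
  rewrite -setI_eq0; apply: contraNT KL => /set0Pn[y]; rewrite inE => /andP[yK yL].
  by rewrite (common K L y).
have -> : (3 * #|P| = #|cover (nbr @: P)|)%N.
  rewrite -(eqP tI) big_imset //= mulnC -sum_nat_const.
  apply: eq_bigr => K /heavyP[K4 _ xK].
  by have := cardsD1 x K; rewrite xK K4 /nbr; clear; lia.
apply: degree_ge => s /bigcupP[_ /imsetP[K /heavyP[_ /cliqueP cK xK] ->]].
by rewrite in_setD1 => /andP[sx sK]; apply: cK; rewrite // eq_sym.
Qed.

(* Discharging: the sum of 4 - degree x over all vertices is 4, whereas every
   vertex of degree 3 lies in a heavy clique, and these cliques have at least
   as many vertices of degree at least 5 as of degree 3. *)
Lemma heavy_contradiction (H : gain_multigraph) :
  tight22 H -> (forall x : vertex H, 3 <= degree x)%N ->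
  (forall x : vertex H, degree x = 3%N ->
     exists2 K : {set vertex H}, heavy K & x \in K) ->
  False.
Proof.
move=> /tight22E[cE spH] d3 d3K.
pose P := [set K : {set vertex H} | heavy K].
pose big (x : vertex H) := (5 <= degree x)%N.
have sumd := sum_degree spH.
have le1 : (\sum_(x : vertex H) (degree x == 3) <=
  \sum_(K in P) \sum_(x in K) (degree x == 3))%N.
  rewrite (exchange_big_dep predT) //=; apply: leq_sum => x _.
  case: eqP => // /d3K[K hK xK].
  by rewrite (bigD1 K) //= inE hK.
have le2 : (\sum_(K in P) \sum_(x in K) (degree x == 3) <=
  \sum_(K in P) \sum_(x in K) big x)%N.
  apply: leq_sum => K; rewrite inE => /and3P[/eqP K4 _ hK].
  have : (\sum_(x in K) (degree x == 3) + \sum_(x in K) big x <= #|K|)%N.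
    rewrite -big_split -sum1_card /=; apply: leq_sum => x _.
    by rewrite /big; case: eqP => [->|_] //; case: (4 < degree x)%N.
  suff : (2 <= \sum_(x in K) big x)%N by rewrite K4; clear; lia.
  apply: leq_trans hK _; rewrite -sum1_card (eq_bigl (fun x => (x \in K) && big x)); last first.
    by move=> x; rewrite inE.
  by rewrite big_mkcondr /=; apply: leq_sum => x _; case: (big x).
have le3 : (\sum_(K in P) \sum_(x in K) big x <= \sum_(x : vertex H) (degree x - 4))%N.
  rewrite (exchange_big_dep predT) //=; apply: leq_sum => x _.
  rewrite sum_nat_const; have := card_heavy_at x spH.
  have -> : [set K : {set vertex H} | heavy K & x \in K] = [set K in P | x \in K].
    by apply/setP=> K; rewrite !inE.
  have -> : #|[pred K in P | x \in K]| = #|[set K in P | x \in K]| by rewrite cardsE.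
  by rewrite /big; case: leqP => /=; clear; lia.
have : (\sum_(x : vertex H) (degree x + (degree x == 3)) =
  \sum_(x : vertex H) (4 + (degree x - 4)))%N.
  apply: eq_bigr => x _; have := d3 x; case: eqP => [->|]//=; clear; lia.
have sum4 : (\sum_(x : vertex H) 4 = #|vertex H| * 4)%N by rewrite sum_nat_const.
rewrite !big_split /= sumd sum4.
by move: le1 le2 le3 cE; clear; lia.
Qed.

Lemma tight_reducible (H : gain_multigraph) :
  is_gain_graph H -> tight22 H -> (1 < #|vertex H|)%N -> reducible H.
Proof.
move=> gH tH V1.
case: (boolP [exists v : vertex H, (degree v == 2)%N])
  => [/existsP[v /cards2P[e1 [e2 [e12 incE]]]]|].
  have [a [ga eE1]] : exists w g, is_edge e1 v w g.
    by apply/incidentP; rewrite incE !inE eqxx.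
  have [b [gb eE2]] : exists w g, is_edge e2 v w g.
    by apply/incidentP; rewrite incE !inE eqxx orbT.
  exact: zero_reduction incE eE1 eE2.
rewrite negb_exists => /forallP d2.
case: (boolP [forall v : vertex H, (degree v == 3)%N ==>
    [exists K : {set vertex H}, heavy K && (v \in K)]]) => [/forallP d3K|].
  case: (heavy_contradiction tH) => x.
    by have := degree_ge2 x tH V1; have := d2 x; clear; lia.
  by move=> /eqP; have /implyP/[apply]/existsP[K /andP[]] := d3K x; exists K.
rewrite negb_forall => /existsP[v]; rewrite negb_imply => /andP[/eqP d3 nK].
have [//|[K hK vK]] := degree3_heavy gH tH d3.
by case/existsP: nK; exists K; rewrite hK.
Qed.

Theorem theorem9p4 (G : gain_multigraph) (hG : is_gain_graph G) :
  tight22 G <-> constructible G.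
Proof.
split; last first.
  elim=> [H V1 E0|H H' _ tH [] m _].
  - apply/tight22E; split=> [|A A0]; first by rewrite V1 E0.
    have := subset_leq_card (subsetT (induced (@label H) A)); rewrite cardsT E0.
    by move: A0; rewrite -card_gt0; clear; lia.
  - exact: zero_extension_tight tH.
  - exact: one_extension_tight tH.
  - exact: edge_to_K3_tight tH.
  - exact: vertex_to_K4_tight tH.
have [n] := ubnP #|vertex G|; elim: n G hG => // n IHn H gH ltn tH.
case: (ltnP 1 #|vertex H|) => V1; last first.
  have [cE _] := tH; have V1' : #|vertex H| = 1%N by move: cE V1; clear; lia.
  by apply: constructible_K1 => //; move: cE; rewrite V1'; clear; lia.
have [G [gG tG ltG m]] := tight_reducible gH tH V1.
by apply: (constructible_move (G := G)) => //; apply: IHn => //; move: ltG ltn; clear; lia.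
Qed.
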